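(* Let $(X,f)$ be a dynamical system with $f$ Lipschitz, and suppose there are a non-empty compact set $Y\subseteq X$ and a positive integer $N$ such that $f^N(Y)=Y$, $X=\bigcup_{l=0}^{N-1}f^l(Y)$, and $(Y,f^N)$ has the exponential non-uniform specification property with respect to the exponent $(N\lambda_1,N\lambda_2)$ at some scale $\varepsilon_0>0$. Let $\varphi:\mathbb N\to(0,1]$ be such that $\overline\tau<\lambda_1$, where $\overline\tau:=\limsup_{n\to\infty}-\frac{\ln\varphi(n)}{n}$. For $x\in X$ put $\mathfrak C(f,\varphi,x):=\{y\in X: d(f^n(x),y)<\varphi(n)\text{ for infinitely many }n\in\mathbb N\}$. Then the set $\mathfrak D(f,\varphi):=\{x\in X:\mathfrak C(f,\varphi,x)\text{ is dense in }X\}$ is non-empty and $$h_{top}(f,\mathfrak D(f,\varphi))\ge\frac{\lambda_1\lambda_2-\lambda_2\overline\tau}{\lambda_1\lambda_2+\lambda_1\overline\tau}\,h_{top}(f,X).$$ Moreover: (1) if further $f:X\to X$ is an $L$-Lipschitz map, then $$\dim_H\mathfrak D(f,\varphi)\ge\frac1{\ln L}\,\frac{\lambda_1\lambda_2-\lambda_2\overline\tau}{\lambda_1\lambda_2+\lambda_1\overline\tau}\,h_{top}(f,X);$$ (2) if further $f:X\to X$ is an $(L_1,L_2)$-bi-Lipschitz homeomorphism, then $$\dim_H\mathfrak D(f,\varphi)\ge\Big(\frac1{\ln L_1}+\frac1{\ln L_2}\,\frac{\lambda_1\lambda_2-\lambda_2\overline\tau}{\lambda_1\lambda_2+\lambda_1\overline\tau}\Big)h_{top}(f,X).$$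 In particular, when $N=1$, all of these results hold with $\overline\tau$ replaced everywhere (including in the hypothesis $\overline\tau<\lambda_1$) by $\underline\tau:=\liminf_{n\to\infty}-\frac{\ln\varphi(n)}{n}$.
   Context: $\mathbb N$ is the set of non-negative integers. A dynamical system $(X,f)$ consists of a compact metric space $(X,d)$ with at least two points and a continuous map $f:X\to X$. Lipschitz conditions: $f$ is $L$-Lipschitz if $\sup_{x\ne y}\frac{d(f(x),f(y))}{d(x,y)}\le L<\infty$ (and Lipschitz if this holds for some $L$). $f$ is an $(L_1,L_2)$-bi-Lipschitz homeomorphism if it is a homeomorphism with $\sup_{x\neq y}\frac{d(f^{-1}(x),f^{-1}(y))}{d(x,y)}\le L_1<\infty$ and $\sup_{x\neq y}\frac{d(f(x),f(y))}{d(x,y)}\le L_2<\infty$. For a system $(W,g)$, the exponential Bowen ball is $B_n(x,\varepsilon,\lambda_1,\lambda_2,g):=\{y\in W: d(g^i(x),g^i(y))<\varepsilon e^{-\min\{i\lambda_1,(n-1-i)\lambda_2\}}\text{ for all }0\le i\le n-1\}$, where $n\ge1$ and $\varepsilon,\lambda_1,\lambda_2>0$. $(W,g)$ has the exponential non-uniform specification property with respect to the exponent $(\lambda_1,\lambda_2)$ at scale $\varepsilon$ if for every $n\ge1$ there is a positive integer $p(n,\varepsilon)$ with $\limsup_{n\to\infty}\frac1n p(n,\varepsilon)=0$ such that: for any points $x_1,\dots,x_k\in W$, positive integers $n_1,\dots,n_k$, and $p_i\ge p(n_i,\varepsilon)$, there is $z\in W$ with $z\in B_{n_1}(x_1,\varepsilon,\lambda_1,\lambda_2,g)$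 and $g^{n_1+p_1+\cdots+n_{i-1}+p_{i-1}}(z)\in B_{n_i}(x_i,\varepsilon,\lambda_1,\lambda_2,g)$ for every $2\le i\le k$. Bowen topological entropy of a subset $Z\subseteq X$: let $B_n(x,\varepsilon,f)=\{y: d(f^i(x),f^i(y))<\varepsilon,\ 0\le i\le n-1\}$. For $s\ge0$, $M\ge 1$, $\varepsilon>0$ let $\mathcal M^s_{M,\varepsilon}(Z)=\inf\sum_i e^{-sn_i}$ over finite or countable families $\{B_{n_i}(x_i,\varepsilon,f)\}$ covering $Z$ with $x_i\in X$, $n_i\ge M$; $\mathcal M^s_\varepsilon(Z)=\lim_{M\to\infty}\mathcal M^s_{M,\varepsilon}(Z)$; $h_{top}(f,Z,\varepsilon)=\inf\{s:\mathcal M^s_\varepsilon(Z)=0\}$; $h_{top}(f,Z)=\lim_{\varepsilon\to0}h_{top}(f,Z,\varepsilon)$. For $Z=X$ this is the classical topological entropy. $\dim_H$ is Hausdorff dimension with respect to $d$. *)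

(* Defs.v *)
From HB Require Import structures.
From mathcomp Require Import all_boot all_order all_algebra.
From mathcomp Require Import all_classical all_reals all_analysis.
Import Order.TTheory GRing.Theory Num.Theory.
Import numFieldNormedType.Exports.

Set Implicit Arguments.
Unset Strict Implicit.
Unset Printing Implicit Defensive.

Local Open Scope classical_set_scope.
Local Open Scope ring_scope.

Section dynamics.
Context {R : realType} {X : metricType R}.
Implicit Types (f g : X -> X) (W Z : set X) (phi : nat -> R).

Definition dynamical_system f : Prop :=
  [/\ compact [set: X], exists x y : X, x != y & continuous f].

Definition lipschitz_const f : \bar R :=
  ereal_sup [set (mdist (f p.1) (f p.2) / mdist p.1 p.2)%:E
            | p in [set p : X * X | p.1 != p.2]].

Definition lipschitz_with (L : R) f : Prop := (lipschitz_const f <= L%:E)%E.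

(* [L1] bounds the inverse of [f] and [L2] bounds [f]. *)
Definition bilipschitz_homeo (L1 L2 : R) f : Prop :=
  exists g : X -> X,
    [/\ cancel f g, cancel g f, continuous f & continuous g] /\
    lipschitz_with L1 g /\ lipschitz_with L2 f.

(* The system is [(W, g)] with [W] a subset of [X] carrying the restricted
   metric. The truncated subtraction [n.-1 - i] is exact since [i < n]. *)
Definition exp_bowen_ball W g (n : nat) (x : X) (eps lambda1 lambda2 : R) :
    set X :=
  [set y | W y /\ forall i, (i < n)%N ->
     mdist (iter i g x) (iter i g y) <
     eps * expR (- Num.min (i%:R * lambda1) ((n.-1 - i)%:R * lambda2))].

(* The requirement on the first orbit segment is the case of the index [0],
   where the sum is empty. *)
Definition exp_nonuniform_specification W g (lambda1 lambda2 eps : R) : Prop :=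
  exists p : nat -> nat,
    [/\ forall n, (0 < n)%N -> (0 < p n)%N,
        limn_esup (fun n => ((p n)%:R / n%:R : R)%:E) = 0%E &
        forall (k : nat) (x : 'I_k -> X) (n q : 'I_k -> nat), (0 < k)%N ->
          (forall i, W (x i)) -> (forall i, (0 < n i)%N) ->
          (forall i, (p (n i) <= q i)%N) ->
          exists2 z, W z & forall i : 'I_k,
            exp_bowen_ball W g (n i) (x i) eps lambda1 lambda2
              (iter (\sum_(j < k | (j < i)%N) (n j + q j))%N g z)].

Definition bowen_ball f (n : nat) (x : X) (eps : R) : set X :=
  [set y | forall i, (i < n)%N -> mdist (iter i f x) (iter i f y) < eps].

(* Finite or countable families are indexed by arbitrary subsets of [nat]. *)
Definition bowen_premeasure f Z (s : R) (M : nat) (eps : R) : \bar R :=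
  ereal_inf [set v | exists (A : set nat) (x : nat -> X) (n : nat -> nat),
    [/\ forall i, A i -> (M <= n i)%N,
        Z `<=` \bigcup_(i in A) bowen_ball f (n i) (x i) eps &
        v = \esum_(i in A) (expR (- (s * (n i)%:R)))%:E]].

Definition bowen_measure f Z (s eps : R) : \bar R :=
  limn (fun M => bowen_premeasure f Z s M eps).

Definition htop_scale f Z (eps : R) : \bar R :=
  ereal_inf [set s%:E | s in [set s : R | 0 <= s /\ bowen_measure f Z s eps = 0%E]].

Definition htop f Z : \bar R := lim (htop_scale f Z eps @[eps --> 0^'+]).

Definition diam Z : \bar R :=
  ereal_sup [set (mdist p.1 p.2)%:E | p in Z `*` Z].

(* Members of a cover have diameter at most [delta], so [fine] is harmless.
   Here [0 `^ 0 = 1]: for [s = 0] the sum counts the members of the cover. *)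
Definition hausdorff_premeasure Z (s delta : R) : \bar R :=
  ereal_inf [set v | exists (A : set nat) (U : nat -> set X),
    [/\ forall i, A i -> (diam (U i) <= delta%:E)%E,
        Z `<=` \bigcup_(i in A) U i &
        v = \esum_(i in A) (fine (diam (U i)) `^ s)%:E]].

Definition hausdorff_measure Z (s : R) : \bar R :=
  lim (hausdorff_premeasure Z s delta @[delta --> 0^'+]).

Definition hausdorff_dim Z : \bar R :=
  ereal_inf [set s%:E | s in [set s : R | 0 <= s /\ hausdorff_measure Z s = 0%E]].

Definition covered_set f phi (x : X) : set X :=
  [set y | infinite_set [set n : nat | mdist (iter n f x) y < phi n]].

Definition dense_covering_points f phi : set X :=
  [set x | dense (covered_set f phi x)].

End dynamics.

Section rates.
Context {R : realType}.
Implicit Type phi : nat -> R.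

Definition upper_rate phi : \bar R :=
  limn_esup (fun n => (- ln (phi n) / n%:R)%:E).

Definition lower_rate phi : \bar R :=
  limn_einf (fun n => (- ln (phi n) / n%:R)%:E).

Definition entropy_factor (lambda1 lambda2 tau : R) : R :=
  (lambda1 * lambda2 - lambda2 * tau) / (lambda1 * lambda2 + lambda1 * tau).

End rates.

(* Main.v *)
Require Import Defs.
From HB Require Import structures.
From mathcomp Require Import all_boot all_order all_algebra.
From mathcomp Require Import all_classical all_reals all_analysis.
From mathcomp Require Import finmap zify ring lra.
Import Order.TTheory GRing.Theory Num.Theory.
Import numFieldNormedType.Exports.
Local Open Scope classical_set_scope.
Local Open Scope ring_scope.

(* Write [g = f^N], [tau] for the rate of [phi] and [c] for the entropy factor.
   Along very sparse times [t] the orbit is forced to shadow a prescribed point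
   from [t - tau t / lambda1] to [t + tau t / lambda2]: by the exponential
   precision of the shadowing it comes [phi]-close to that point at time [t].
   The remaining time is filled with freely chosen blocks from a large separated
   set. Just after a hit at [t], the free part of the elapsed time
   [t (1 + tau / lambda2)] is about [t (1 - tau / lambda1)], and [c] is the
   quotient of the two. The points that realize all the hits form a closed subset
   of the set in question, so a cover of it by open sets may be replaced by a
   finite one and only finitely many hits matter; counting the choices of blocks
   compatible with each set of the cover then replaces a mass distribution
   principle. Free blocks placed before time 0 give the two-sided version needed
   for bi-Lipschitz homeomorphisms. *)

Set Implicit Arguments.
Unset Strict Implicit.
Unset Printing Implicit Defensive.

(** A nonempty [A] lies in a product of fibres that are singletons over [F] and all of [J]
    elsewhere. Keeping [#|J| ^ #|F|] on the left avoids a subtraction in the exponent. *)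
Lemma card_ffun_agree (I J : finType) (A : {set {ffun I -> J}}) (F : {set I}) :
  (forall u v i, u \in A -> v \in A -> i \in F -> u i = v i) ->
  (#|A| * #|J| ^ #|F| <= #|J| ^ #|I|)%N.
Proof.
move=> agree.
have [->|[u uA]] := set_0Vmem A; first by rewrite cards0.
pose B i : {pred J} := if i \in F then pred1 (u i) else predT.
have AB : (#|A| <= #|family B|)%N.
  apply: subset_leq_card; apply/fintype.subsetP => v vA; apply/familyP => i.
  rewrite /B; case: ifPn => [iF|//]; first by rewrite inE (agree v u).
have -> : (#|J| ^ #|I| = #|family B| * #|J| ^ #|F|)%N.
  rewrite card_family foldrE big_map -(cardC (mem F)) expnD mulnC; congr muln.
  rewrite big_enum (bigID (mem F)) /= big1 => [|i iF]; last first.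
    by rewrite /B iF card1.
  rewrite mul1n (eq_bigr (fun=> #|J|)) => [|i /negPf iF]; last by rewrite /B iF.
  by rewrite prod_nat_const; congr expn; apply: eq_card => i; rewrite !inE.
by rewrite leq_mul2r AB orbT.
Qed.

(** * Shadowing from prescribed starting times *)

Section specification.
Context {R : realType} {X : metricType R}.
Implicit Types (f g : X -> X) (W : set X).

(** The gaps may be any numbers above [p], so each one is stretched until the next block starts
    exactly at the next listed multiple of [l]. *)
Lemma spec_starts W g (a1 a2 eps : R) (p : nat -> nat) (l : nat)
    (v : seq nat) (x : nat -> X) (n : nat -> nat) :
  (forall (k : nat) (x : 'I_k -> X) (n q : 'I_k -> nat), (0 < k)%N ->
     (forall i, W (x i)) -> (forall i, (0 < n i)%N) ->
     (forall i, (p (n i) <= q i)%N) ->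
     exists2 z, W z & forall i : 'I_k,
       exp_bowen_ball W g (n i) (x i) eps a1 a2
         (iter (\sum_(j < k | (j < i)%N) (n j + q j))%N g z)) ->
  path ltn 0%N v ->
  (forall i, i \in 0%N :: v -> W (x i)) ->
  (forall i, i \in 0%N :: v -> (0 < n i)%N) ->
  (forall i i', i \in 0%N :: v -> i' \in 0%N :: v -> (i < i')%N ->
     (n i + p (n i) <= (i' - i) * l)%N) ->
  exists2 z, W z & forall i, i \in 0%N :: v ->
     exp_bowen_ball W g (n i) (x i) eps a1 a2 (iter (i * l) g z).
Proof.
move=> spec v_sorted Wx n_gt0 gap.
set u := 0%N :: v; pose k := size u; pose t := nth 0%N u.
have t_in i : (i < k)%N -> t i \in u by move=> ik; exact: mem_nth.
have t_lt i : (i.+1 < k)%N -> (t i < t i.+1)%N.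
  by move=> ik; apply: (pathP 0%N v_sorted).
(* The last block has no successor; its gap is the smallest admissible one. *)
pose q i := if (i.+1 < k)%N then ((t i.+1 - t i) * l - n (t i))%N
            else p (n (t i)).
have pq i : (i < k)%N -> (p (n (t i)) <= q i)%N.
  move=> ik; rewrite /q; case: ifPn => // ik1.
  by have := gap _ _ (t_in _ ik) (t_in _ ik1) (t_lt _ ik1); lia.
have start i : (i < k)%N ->
    (\sum_(j < i) (n (t j) + q j))%N = (t i * l)%N.
  elim: i => [_|i IHi ik]; first by rewrite big_ord0.
  have ik' := ltnW ik.
  rewrite big_ord_recr /= IHi // /q ik.
  have := gap _ _ (t_in _ ik') (t_in _ ik) (t_lt _ ik).
  have := t_lt _ ik; nia.
have [||||z Wz zP] := spec k (fun i => x (t i)) (fun i => n (t i))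
    (fun i => q i).
- by [].
- by move=> i; apply/Wx/t_in.
- by move=> i; apply/n_gt0/t_in.
- by move=> i; apply: pq.
exists z => // i iu.
have ik : (index i u < k)%N by rewrite index_mem.
have tE : t (index i u) = i by rewrite /t nth_index.
have /= := zP (Ordinal ik); rewrite tE.
have -> : (\sum_(j < k | j < index i u) (n (t j) + q j) = i * l)%N.
  rewrite -[in RHS]tE -start // (big_ord_widen k (fun j => n (t j) + q j)%N) //.
  exact: ltnW.
by [].
Qed.

Lemma lipschitz_withP (L : R) f : lipschitz_with L f ->
  forall x y, mdist (f x) (f y) <= L * mdist x y.
Proof.
move=> fL x y; have [->|xy] := eqVneq x y; first by rewrite !mdistxx mulr0.
rewrite -ler_pdivrMr ?mdist_gt0 //.
rewrite -lee_fin; apply: le_trans fL.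
by apply: ereal_sup_ubound; exists (x, y).
Qed.

Lemma iter_lipschitz (L : R) f : 0 <= L ->
  (forall x y, mdist (f x) (f y) <= L * mdist x y) ->
  forall n x y, mdist (iter n f x) (iter n f y) <= L ^+ n * mdist x y.
Proof.
move=> L0 fL; elim=> [|n IHn] x y; first by rewrite expr0 mul1r.
by rewrite exprS -mulrA /=; apply: le_trans (fL _ _) _; rewrite ler_wpM2l.
Qed.

End specification.

(** * Scheduling hits and free blocks *)

(* Time is cut into cells; the [j]-th hit occupies the cells [[s j, E j.+1)]. *)
Section schedule.
Variables s E : nat -> nat.
Hypothesis E0 : E 0%N = 0%N.
Hypothesis Es : forall j, (E j <= s j < E j.+1)%N.

Definition free_cell (i : nat) : bool :=
  `[< forall j, ~~ (s j <= i < E j.+1)%N >].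

Lemma sched_mono i j : (i <= j)%N -> (E i <= E j)%N.
Proof.
move=> /subnK <-; elim: (j - i)%N => // k IHk.
by rewrite addSn; have := Es (k + i); lia.
Qed.

Lemma sched_lt i j : (i < j)%N -> (E i.+1 <= s j)%N.
Proof. by move=> ij; have := Es j; have := sched_mono ij; lia. Qed.

Lemma sched_ge j : (j <= E j)%N.
Proof. by elim: j => // j IHj; have := Es j; lia. Qed.

Lemma sched_inj : injective s.
Proof.
move=> i j sij; have [ij|ji|//] := ltngtP i j.
  by have := sched_lt ij; have := Es i; lia.
by have := sched_lt ji; have := Es j; lia.
Qed.

Lemma free_cell_between j i : (E j <= i < s j)%N -> free_cell i.
Proof.
move=> iE; apply/asboolP => k; apply/negP => ik.
have [jk|kj|jk] := ltngtP j k.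
- by have := sched_lt jk; have := Es j; lia.
- by have := sched_mono kj; lia.
- by rewrite jk in iE; lia.
Qed.

(** The free stretch [[E j, s j)] alone makes up the proportion [c] of all cells before [E j.+1],
    which settles every count that ends inside a hit. Within a free stretch the count grows by one
    per cell, and [c <= 1] suffices. *)
Lemma free_cell_count {R : realDomainType} (c : R) (c0 : 0 <= c) (c1 : c <= 1) :
  (forall j, c * (E j.+1)%:R <= (s j)%:R - (E j)%:R) ->
  forall k, c * k%:R <= (\sum_(0 <= i < k) free_cell i)%N%:R.
Proof.
move=> cE k.
suff H j i : (i <= E j)%N -> c * i%:R <= (\sum_(0 <= a < i) free_cell a)%N%:R.
  exact: H (sched_ge k).
elim: j i => [|j IHj] i.
  by rewrite E0 leqn0 => /eqP->; rewrite mulr0 ler0n.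
move=> iE; have [/IHj//|Ei] := leqP i (E j).
have split_count m : (E j <= m)%N -> (m <= s j)%N ->
    (\sum_(0 <= a < m) free_cell a = \sum_(0 <= a < E j) free_cell a + (m - E j))%N.
  move=> Em ms; rewrite (big_cat_nat (n := E j)) //=; congr addn.
  rewrite (eq_big_nat _ _ (F2 := fun=> 1%N)) => [|a aE].
    by rewrite sum_nat_const_nat muln1.
  by rewrite (@free_cell_between j) //; lia.
have [is_|si] := leqP i (s j).
  rewrite split_count //; last exact: ltnW.
  have := IHj _ (leqnn (E j)).
  rewrite natrD natrB; last exact: ltnW.
  have : (E j)%:R <= i%:R :> R by rewrite ler_nat ltnW.
  nra.
have Esj : (E j <= s j)%N by case/andP: (Es j).
have -> : (\sum_(0 <= a < i) free_cell a =
    \sum_(0 <= a < E j) free_cell a + (s j - E j) +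
    \sum_(s j <= a < i) free_cell a)%N.
  by rewrite -split_count // -big_cat_nat //= ltnW.
rewrite natrD natrD natrB //.
have := cE j.
have : (i%:R : R) <= (E j.+1)%:R by rewrite ler_nat.
have : (0 : R) <= (\sum_(0 <= a < E j) free_cell a)%N%:R by rewrite ler0n.
have : (0 : R) <= (\sum_(s j <= a < i) free_cell a)%N%:R by rewrite ler0n.
nra.
Qed.

(* [O] free cells precede the origin of the schedule, and [om] prescribes the
   block followed in each free cell. *)
Lemma layout {R : realType} {X : metricType R} (W : set X) (g : X -> X)
    (a1 a2 eps : R) (p : nat -> nat) (l : nat)
    (v : nat -> X) (len : nat -> nat) (n1 : nat) (w : nat -> X) (O K : nat) :
  (forall (k : nat) (x : 'I_k -> X) (n q : 'I_k -> nat), (0 < k)%N ->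
     (forall i, W (x i)) -> (forall i, (0 < n i)%N) ->
     (forall i, (p (n i) <= q i)%N) ->
     exists2 z, W z & forall i : 'I_k,
       exp_bowen_ball W g (n i) (x i) eps a1 a2
         (iter (\sum_(j < k | (j < i)%N) (n j + q j))%N g z)) ->
  (0 < K)%N ->
  (forall j, W (v j)) -> (forall a, W (w a)) ->
  (forall j, (0 < len j)%N) -> (0 < n1)%N ->
  (forall j, (len j + p (len j) <= (E j.+1 - s j) * l)%N) ->
  (n1 + p n1 <= l)%N ->
  forall om : nat -> nat, exists2 z, W z &
    (forall a, (a < O + K)%N -> (a < O)%N || free_cell (a - O) ->
       exp_bowen_ball W g n1 (w (om a)) eps a1 a2 (iter (a * l) g z)) /\
    (forall j, (s j < K)%N ->
       exp_bowen_ball W g (len j) (v j) eps a1 a2 (iter ((O + s j) * l) g z)).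
Proof.
move=> spec K0 Wv Ww len0 n10 lenp n1p om.
have s_ge j : (j <= s j)%N.
  by apply: leq_trans (sched_ge j) _; case/andP: (Es j).
(* The hit starting at cell [a], if any; indices below [K] are enough because [j <= s j]. *)
pose jof a := [pick j : 'I_K | O + s j == a]%N.
pose start a := [|| (a < O)%N, free_cell (a - O) | jof a != None].
have jofS j : (s j < K)%N -> exists2 i : 'I_K, jof (O + s j)%N = Some i & i = j :> nat.
  move=> sK; rewrite /jof; case: pickP => [i /eqP/addnI/sched_inj ij|].
    by exists i.
  by move/(_ (Ordinal (leq_ltn_trans (s_ge j) sK))); rewrite eqxx.
have jofN a : (a < O)%N || free_cell (a - O) -> jof a = None.
  rewrite /jof; case: pickP => [i /eqP<-|//].
  rewrite addKn ltnNge leq_addr /= => /asboolP/(_ i).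
  by have := Es i; lia.
(* The list of starts has to begin with 0: if there is no earlier cell and cell 0 is not free, then
   it is the start of a hit. *)
have start0 : start 0%N.
  rewrite /start sub0n; have [//|O0 /=] := ltnP 0 O.
  have [/=|] := boolP (free_cell 0) => // /asboolPn/existsNP[j /negP].
  rewrite negbK leqn0 => /andP[/eqP s0 _].
  have [|i] := jofS j; first by rewrite s0.
  by rewrite s0 addn0; move: O0; rewrite leqn0 => /eqP-> ->.
have u_def : [seq a <- iota 0 (O + K) | start a] =
    0%N :: [seq a <- iota 1 (O + K).-1 | start a].
  by case: (O + K)%N (ltn_addl O K0) => // m _ /=; rewrite start0.
have u_sorted := iota_ltn_sorted 0 (O + K).
have := sorted_filter ltn_trans start u_sorted.
rewrite u_def /= => u_path.
pose xx a := if jof a is Some j then v j else w (om a).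
pose nn a := if jof a is Some j then len j else n1.
have [|||z Wz zP] := @spec_starts R X W g a1 a2 eps p l _ xx nn spec u_path.
- by move=> a _; rewrite /xx; case: (jof a).
- by move=> a _; rewrite /nn; case: (jof a).
- move=> a a'; rewrite -u_def !mem_filter => /andP[_ _] /andP[sa' _] aa'.
  rewrite /nn; case ja: (jof a) => [j|]; last first.
    by apply: leq_trans n1p _; rewrite leq_pmull // subn_gt0.
  move: ja; rewrite /jof; case: pickP => // j' /eqP aE [jj']; rewrite {}jj' in aE.
  apply: leq_trans (lenp j) _; rewrite leq_mul2r; apply/orP; right.
  (* The next start is either a free cell, hence outside the [j]-th hit, or the start of a later
     hit. *)
  suff : (O + E j.+1 <= a')%N by lia.
  case/or3P: sa' => [|/asboolP/(_ j)|]; [lia|lia|].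
  rewrite /jof; case: pickP => // i /eqP iE _.
  have : (j < i)%N.
    rewrite ltnNge; apply/negP; rewrite leq_eqVlt => /orP[/eqP ij|/sched_lt].
      by rewrite -iE ij in aa'; lia.
    by have := Es i; lia.
  by move/sched_lt; lia.
exists z => //; split => [a aK sa|j sK].
  have := zP a; rewrite -u_def mem_filter mem_iota /= add0n aK andbT.
  by rewrite /xx /nn (jofN a) //; apply; rewrite /start orbA sa.
have [i jE ij] := jofS _ sK.
have := zP (O + s j)%N; rewrite -u_def mem_filter mem_iota /= add0n ltn_add2l sK.
by rewrite /xx /nn /start jE ij /= !orbT; apply.
Qed.

End schedule.

(** * Entropy and separated sets *)

Section limits.
Context {R : realType}.

Lemma limn_esup_lt_near (u : nat -> \bar R) (a : \bar R) :
  (limn_esup u < a)%E -> exists M, forall n, (M <= n)%N -> (u n < a)%E.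
Proof.
move=> /ereal_inf_lt[_ [A [M _ MA] <-] ua]; exists M => n Mn.
apply: le_lt_trans ua; apply: ereal_sup_ubound; exists n => //.
exact: MA.
Qed.

Lemma limn_einf_lt_frequently (u : nat -> \bar R) (a : \bar R) :
  (limn_einf u < a)%E -> forall M, exists2 n, (M <= n)%N & (u n < a)%E.
Proof.
move=> ua M; apply/not_exists2P => H; move: ua; apply/negP; rewrite -leNgt.
rewrite leeNr; apply: le_trans (ereal_inf_lbound _) _.
  by exists [set n | (M <= n)%N] => //=; exists M.
apply: ge_ereal_sup => _ [n /= Mn <-]; rewrite leeN2.
by have [//|/negP] := H n; rewrite -leNgt.
Qed.

End limits.

Section entropy.
Context {R : realType} {X : metricType R}.
Implicit Types (f g : X -> X) (Z : set X).

Lemma bowen_premeasure_ge0 f Z s M eps : (0 <= bowen_premeasure f Z s M eps)%E.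
Proof.
apply: le_ereal_inf_tmp => _ [A [x [n [_ _ ->]]]].
by apply: esum_ge0 => i _; rewrite lee_fin expR_ge0.
Qed.

Lemma bowen_measureE f Z s eps :
  bowen_measure f Z s eps =
  ereal_sup (range (fun M => bowen_premeasure f Z s M eps)).
Proof.
apply/cvg_lim => //; apply: ereal_nondecreasing_cvgn => M M' MM'.
apply: ereal_inf_le_tmp => _ [A [x [n [Mn Zc ->]]]].
by exists A, x, n; split => // i /Mn; apply: leq_trans.
Qed.

Lemma bowen_premeasure_le f Z s M eps eps' : eps <= eps' ->
  (bowen_premeasure f Z s M eps' <= bowen_premeasure f Z s M eps)%E.
Proof.
move=> ee; apply: ereal_inf_le_tmp => _ [A [x [n [Mn Zc ->]]]].
exists A, x, n; split => // y /Zc[i Ai yi]; exists i => // k kn.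
exact: lt_le_trans (yi _ kn) ee.
Qed.

Lemma bowen_premeasure_le_measure f Z s M eps :
  (bowen_premeasure f Z s M eps <= bowen_measure f Z s eps)%E.
Proof. by rewrite bowen_measureE; apply: ereal_sup_ubound; exists M. Qed.

Lemma htop_scale_le f Z eps eps' : eps <= eps' ->
  (htop_scale f Z eps' <= htop_scale f Z eps)%E.
Proof.
move=> ee; apply: ereal_inf_le_tmp => _ [s [s0 sM] <-].
exists s => //; split => //; apply/eqP; rewrite eq_le; apply/andP; split.
  rewrite bowen_measureE; apply: ge_ereal_sup => _ [M _ <-].
  rewrite -sM; apply: le_trans (bowen_premeasure_le _ _ _ _ ee) _.
  exact: bowen_premeasure_le_measure.
by apply: le_trans (bowen_premeasure_le_measure _ _ _ 0%N _);
  apply: bowen_premeasure_ge0.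
Qed.

Lemma htopE f Z :
  htop f Z = ereal_sup (htop_scale f Z @` [set` Interval (BRight 0) (BInfty R false)]).
Proof.
apply/cvg_lim => //.
apply: (nonincreasing_at_right_cvge (BInfty R false)) => // e e' _ _.
exact: htop_scale_le.
Qed.

Lemma htop_scale_le_htop f Z eps : 0 < eps -> (htop_scale f Z eps <= htop f Z)%E.
Proof.
move=> e0; rewrite htopE; apply: ereal_sup_ubound; exists eps => //=.
by rewrite in_itv /= e0.
Qed.

Lemma lt_htop_scale f Z h : (h < htop f Z)%E ->
  exists2 eps, 0 < eps & (h < htop_scale f Z eps)%E.
Proof.
rewrite htopE => /ereal_sup_gt[_ [e e0 <-] he]; exists e => //.
by move: e0; rewrite /= in_itv /= andbT.
Qed.

Lemma htop_ge0 f Z : (0 <= htop f Z)%E.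
Proof.
apply: le_trans (htop_scale_le_htop f Z (@ltr01 R)).
by apply: le_ereal_inf_tmp => _ [s [s0 _] <-]; rewrite lee_fin.
Qed.

Lemma esum_const_ltn (Q : nat) (a : R) : 0 <= a ->
  (\esum_(i in [set i | (i < Q)%N]) a%:E = (Q%:R * a)%:E)%E.
Proof.
move=> a0; rewrite esum_fset; last by move=> i _; rewrite lee_fin.
  by rewrite -fsbig_ord sumEFin big_const_ord iter_addr_0 mulr_natl.
exact: finite_II.
Qed.

(* The points are chosen greedily in [Y]: as long as there are too few of them,
   the balls around their first [N] images do not cover [X]. *)
Lemma separated_orbits f (Y : set X) (N : nat) (h : R) :
  (0 < N)%N -> Y !=set0 -> [set: X] = \bigcup_(l < N) (iter l f @` Y) ->
  0 <= h -> (h%:E < htop f [set: X])%E ->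
  exists eps delta : R, [/\ 0 < eps, 0 < delta & exists M : nat,
    forall n, (M <= n)%N -> exists (P : nat) (E : nat -> X),
    [/\ forall a, Y (E a), delta * expR (h * n%:R) <= P%:R &
      forall a b, (a < b < P)%N -> exists2 i, (i < n + N)%N &
        eps <= mdist (iter i f (E a)) (iter i f (E b))]].
Proof.
move=> N0 [y0 Yy0] XY h0 /lt_htop_scale[eps eps0 hs].
have : (0 < bowen_measure f [set: X] h eps)%E.
  rewrite lt_neqAle; apply/andP; split; last first.
    by apply: le_trans (bowen_premeasure_le_measure _ _ _ 0%N _);
      apply: bowen_premeasure_ge0.
  apply/eqP => hM; move: hs; apply/negP; rewrite -leNgt.
  by apply: ereal_inf_lbound; exists h.
rewrite bowen_measureE => /ereal_sup_gt[_ [M _ <-] M0].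
(* The premeasure may be infinite, so a real lower bound is extracted. *)
have [d0 d00 d0M] : exists2 d0 : R, 0 < d0 &
    (d0%:E < bowen_premeasure f [set: X] h M eps)%E.
  move: M0; case: bowen_premeasure => [r r0| |//].
    exists (r / 2); first by rewrite divr_gt0.
    by rewrite lte_fin; move: r0; rewrite lte_fin; lra.
  by exists 1 => //; rewrite ltry.
have N0' : (0 : R) < N%:R by rewrite ltr0n.
(* The division by [N] accounts for the [N] balls that each chosen point contributes, one per
   image. *)
exists eps, (d0 / N%:R); split; [by []|by rewrite divr_gt0|exists M => n Mn].
set x := (d0 / N%:R) * expR (h * n%:R).
have x0 : 0 < x by rewrite mulr_gt0 ?expR_gt0 ?divr_gt0.
suff sepP P : (P.-1)%:R <= x -> exists E : nat -> X,
    (forall a, Y (E a)) /\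
    forall a b, (a < b < P)%N -> exists2 i, (i < n + N)%N &
        eps <= mdist (iter i f (E a)) (iter i f (E b)).
  have [|E [YE sepE]] := sepP (Num.truncn x).+1.
    by rewrite /= truncn_le // ltW.
  exists (Num.truncn x).+1, E; split => //.
  exact/ltW/truncnS_gt.
elim: P => [|P IHP] Px.
  by exists (fun=> y0); split => // a b; rewrite ltn0 andbF.
have [|E [YE sepE]] := IHP.
  by apply: le_trans Px; rewrite ler_nat leq_pred.
have [y Yy yE] : exists2 y, Y y & forall a, (a < P)%N ->
    exists2 i, (i < n + N)%N & eps <= mdist (iter i f (E a)) (iter i f y).
  apply: contrapT => noy.
  suff : (bowen_premeasure f [set: X] h M eps <= d0%:E)%E.
    by rewrite leNgt d0M.
  apply: ereal_inf_le; exists (((P * N)%N%:R * expR (- (h * n%:R)))%:E).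
    exists [set i | (i < P * N)%N],
      (fun i => iter (i %% N)%N f (E (i %/ N)%N)), (fun=> n); split => //.
      move=> z _; have : [set: X] z by [].
      rewrite XY => -[l /= lN [y Yy <-]].
      apply: contrapT => ncov; apply: noy; exists y => // a aP.
      apply: contrapT => nsep; apply: ncov; exists (a * N + l)%N => /=.
        by rewrite (@leq_trans (a.+1 * N)) ?leq_mul2r ?aP ?orbT// mulSn addnC ltn_add2r.
      rewrite divnMDl // modnMDl modn_small // divn_small // addn0 => i i_n.
      rewrite ltNge; apply/negP => sep; apply: nsep; exists (i + l)%N.
        by rewrite -addnS leq_add // ltnW.
      by rewrite !iterD.
    by rewrite esum_const_ltn // expR_ge0.
  rewrite lee_fin expRN ler_pdivrMr ?expR_gt0 // natrM -ler_pdivlMr //.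
  by rewrite mulrAC; exact: Px.
exists (fun a => if a == P then y else E a); split=> [a|a b].
  by case: ifP.
case/andP=> ab; rewrite ltnS leq_eqVlt => /orP[/eqP bP|bP].
  rewrite bP eqxx in ab *; rewrite (ltn_eqF ab).
  exact: yE.
rewrite (ltn_eqF bP) (ltn_eqF (ltn_trans ab bP)).
by apply: sepE; rewrite ab bP.
Qed.

End entropy.

(** * Separated blocks that survive shadowing *)

Section tracking.
Context {R : realType} {X : metricType R}.
Implicit Types (f g : X -> X) (W : set X).

Lemma iter_iter f N k x : iter k (iter N f) x = iter (k * N) f x.
Proof. by elim: k => //= k ->; rewrite mulSn iterD. Qed.

Lemma iter_image_id g W k : g @` W = W -> forall y, W y ->
  exists2 w, W w & iter k g w = y.
Proof.
move=> gW; elim: k => [|k IHk] y Wy; first by exists y.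
have : (g @` W) y by rewrite gW.
by move=> [z /IHk[w Ww <-] <-]; exists w.
Qed.

Lemma exp_bowen_ball_tracks W g n x eps a1 a2 z (i : nat) (kappa : R) :
  0 < eps -> exp_bowen_ball W g n x eps a1 a2 z -> (i < n)%N ->
  kappa <= i%:R * a1 -> kappa <= (n.-1 - i)%:R * a2 ->
  mdist (iter i g x) (iter i g z) < eps * expR (- kappa).
Proof.
move=> eps0 [_ zx] i_n k1 k2; apply: lt_le_trans (zx _ i_n) _.
by rewrite ler_pM2l // ler_expR lerN2 le_min k1 k2.
Qed.

Lemma gap_small (p : nat -> nat) (eta : R) :
  limn_esup (fun n => ((p n)%:R / n%:R : R)%:E) = 0%E -> 0 < eta ->
  exists M, forall n, (M <= n)%N -> (p n)%:R <= eta * n%:R.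
Proof.
move=> p0 eta0.
have [|M MP] := @limn_esup_lt_near R (fun n => ((p n)%:R / n%:R : R)%:E) eta%:E.
  by rewrite p0 lte_fin.
exists (maxn M 1) => n; rewrite geq_max => /andP[/MP + n0].
by rewrite lte_fin ltr_pdivrMr ?ltr0n // => /ltW.
Qed.

Lemma expR_decay (a b eps : R) : 0 < a -> 0 < eps ->
  exists K : nat, eps * expR (- (K%:R * a)) <= b \/ b <= 0.
Proof.
move=> a0 eps0; have [b0|b0] := lerP b 0; first by exists 0%N; right.
exists (Num.truncn (eps / b / a)).+1; left.
rewrite expRN ler_pdivrMr ?expR_gt0 // -ler_pdivrMl // mulrC.
apply: le_trans (expR_ge1Dx _); rewrite -[leLHS]add0r lerD //.
by rewrite -ler_pdivrMr //; apply/ltW/truncnS_gt.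
Qed.

(** These are the free blocks: segments of separated orbits, padded by [K] steps on both sides so
    that the shadowing error is uniformly small on the core. Padding and gap are paid for by the
    reserve between [h] and a larger [h1] below the entropy. The case [h = 0], served by a single
    block, remains available when the entropy vanishes. *)
Lemma block_exists f (Y : set X) (N : nat) (lambda1 lambda2 eps0 L h : R)
    (p : nat -> nat) :
  0 < lambda1 -> 0 < lambda2 -> 0 < eps0 -> (0 < N)%N ->
  1 <= L -> (forall x y, mdist (f x) (f y) <= L * mdist x y) ->
  Y !=set0 -> iter N f @` Y = Y ->
  [set: X] = \bigcup_(l < N) (iter l f @` Y) ->
  limn_esup (fun n => ((p n)%:R / n%:R : R)%:E) = 0%E ->
  h = 0 \/ 0 <= h /\ (h%:E < htop f [set: X])%E ->
  exists (eps : R) (l n1 P : nat) (w : nat -> X),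
  [/\ [/\ 0 < eps, (0 < n1)%N, (0 < P)%N & (n1 + p n1 <= l)%N],
      forall a, Y (w a),
      expR (h * (N * l)%N%:R) <= P%:R &
      forall a b z z', (a < P)%N -> (b < P)%N -> a != b ->
        exp_bowen_ball Y (iter N f) n1 (w a) eps0 (N%:R * lambda1) (N%:R * lambda2) z ->
        exp_bowen_ball Y (iter N f) n1 (w b) eps0 (N%:R * lambda1) (N%:R * lambda2) z' ->
        exists2 q, (q < n1)%N &
          2 * eps <= mdist (iter q (iter N f) z) (iter q (iter N f) z')].
Proof.
move=> l10 l20 eps00 N0 L1 fL Y0 fNY XY p0 [->|[h0 hh]].
  have [y0 Yy0] := Y0.
  exists 1, (1 + p 1)%N, 1%N, 1%N, (fun=> y0); split => //.
    by rewrite mul0r expR0.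
  by move=> [|a] [|b].
have N0' : (0 : R) < N%:R by rewrite ltr0n.
have [h1 hh1 h1h] : exists2 h1 : R, h < h1 & (h1%:E < htop f [set: X])%E.
  move: hh; case: htop => [r| |] //.
    rewrite lte_fin => hr; exists ((h + r) / 2); rewrite ?lte_fin; lra.
  by move=> _; exists (h + 1); rewrite ?ltry // ltrDl.
have h10 : 0 <= h1 by lra.
have [eps [delta [e0 d0 [M MP]]]] := separated_orbits N0 Y0 XY h10 h1h.
set g := iter N f.
have L0 : 0 < L by lra.
have LN0 : 0 < L ^+ N by rewrite exprn_gt0.
(* Moving a separation time back to a multiple of [N] costs at most [L ^+ N]. Of the remaining
   [4 * eps1], the two tracking errors take [2 * eps1]. *)
pose eps1 := eps / (4 * L ^+ N).
have eps10 : 0 < eps1 by rewrite divr_gt0 // mulr_gt0.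
pose kap := N%:R * Num.min lambda1 lambda2.
have kap0 : 0 < kap by rewrite mulr_gt0 // lt_min l10 l20.
have [K [Kdecay|]] := expR_decay eps1 kap0 eps00; last by rewrite leNgt eps10.
(* Half of the reserve [h1 - h] absorbs the part [h * eta] of the gap; the [+ 1] keeps the
   denominator positive when [h = 0]. *)
pose eta := (h1 - h) / (2 * (h + 1)).
have eta0 : 0 < eta by rewrite divr_gt0 // ?subr_gt0 // mulr_gt0 //; lra.
have [M1 M1P] := gap_small p0 eta0.
(* The costs independent of [n0], from the padding and from [delta]; the other half of the reserve
   absorbs them once [n0] is large. *)
pose B := h * (1 + 2 * K%:R) * (1 + eta) - ln delta / N%:R.
have [n0 [n0M n0M1 n0B]] : exists n0, [/\ (M <= n0)%N, (M1 <= n0)%N &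
    B <= (h1 - h) / 2 * n0%:R].
  exists (M + M1 + (Num.truncn (B / ((h1 - h) / 2))).+1)%N; split.
  - by rewrite -addnA leq_addr.
  - by rewrite addnAC leq_addl.
  rewrite mulrC -ler_pdivrMr; last by lra.
  rewrite natrD; apply: ler_wpDl; first exact: ler0n.
  exact/ltW/truncnS_gt.
(* The core has [n0 + 1] steps: orbits are separated before time [N * n0 + N], that is, within the
   [g]-steps [0] to [n0]. *)
pose n1 := (n0 + 1 + 2 * K)%N.
have [|P [E [YE PE sepE]]] := MP (N * n0)%N.
  by rewrite (leq_trans n0M) ?leq_pmull.
have n1_gt0 : (0 < n1)%N by rewrite /n1 addnAC addn1.
have Pbig : expR (h * (N * (n1 + p n1))%N%:R) <= P%:R.
  apply: le_trans PE; rewrite -[delta in leRHS](lnK _) ?posrE // -expRD ler_expR.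
  have pn1 : (p n1)%:R <= eta * n1%:R :> R.
    apply: M1P.
    by rewrite /n1 -addnA (leq_trans n0M1) ?leq_addr.
  have n1E : n1%:R = n0%:R + (1 + 2 * K%:R) :> R.
    by rewrite /n1 natrD natrD natrM addrA.
  have lB : ln delta = N%:R * (h * (1 + 2 * K%:R) * (1 + eta) - B).
    by rewrite /B opprB addrC subrK mulrC divfK // lt0r_neq0.
  have etaE : h * eta <= (h1 - h) / 2.
    rewrite /eta mulrA ler_pdivrMr ?mulr_gt0 //; [nra|lra].
  rewrite lB !natrM natrD !(mulrCA _ N%:R) -mulrDr ler_pM2l //.
  apply: (@le_trans _ _ (h * (n1%:R + eta * n1%:R))).
    by rewrite ler_wpM2l // lerD2l.
  rewrite n1E.
  have : h * eta * n0%:R <= (h1 - h) / 2 * n0%:R by rewrite ler_wpM2r.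
  move: n0B etaE; set A := _ / 2; move: (1 + 2 * K%:R) => k1.
  have -> : h1 * n0%:R = h * n0%:R + A * n0%:R + A * n0%:R by rewrite /A; lra.
  by clear; lra.
have P0 : (0 < P)%N.
  by rewrite -(ltr0n R); apply: lt_le_trans Pbig; apply: expR_gt0.
(* The block starts [K] steps before the separated point, at a preimage in [Y]. *)
have /choice[w wP] : forall a, exists w, Y w /\ iter K g w = E a.
  by move=> a; have [w Yw wE] := iter_image_id K fNY (YE a); exists w.
exists eps1, (n1 + p n1)%N, n1, P, w; split => //.
  by move=> a; case: (wP a).
have track a z q : exp_bowen_ball Y g n1 (w a) eps0 (N%:R * lambda1) (N%:R * lambda2) z ->
    (q <= n0)%N -> mdist (iter q g (E a)) (iter (q + K) g z) <= eps1.
  move=> za qn; have [_ <-] := wP a; rewrite -iterD; apply: le_trans Kdecay.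
  apply/ltW/(exp_bowen_ball_tracks eps00 za).
  - by rewrite /n1; clear -qn; lia.
  - rewrite /kap mulrCA [leRHS]mulrCA ler_pM2l //.
    by rewrite ler_pM // ?ler_nat ?leq_addl ?ge_min ?lexx // ltW // lt_min l10.
  - rewrite /kap mulrCA [leRHS]mulrCA ler_pM2l //.
    rewrite ler_pM // ?ler_nat // ?ge_min ?lexx ?orbT // ?ltW // ?lt_min ?l10 //.
    by rewrite /n1; clear -qn; lia.
suff sep a b z z' : (a < b < P)%N ->
    exp_bowen_ball Y g n1 (w a) eps0 (N%:R * lambda1) (N%:R * lambda2) z ->
    exp_bowen_ball Y g n1 (w b) eps0 (N%:R * lambda1) (N%:R * lambda2) z' ->
    exists2 q, (q < n1)%N & 2 * eps1 <= mdist (iter q g z) (iter q g z').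
  move=> a b z z' aP bP; rewrite neq_ltn => /orP[ab|ba] za zb.
    by apply: (sep a b); rewrite ?ab.
  have [|q qn qs] := sep b a z' z _ zb za; first by rewrite ba.
  by exists q; rewrite 1?metric_sym.
move=> ab za zb; have [i i_n isep] := sepE _ _ ab.
pose q := (i %/ N)%N.
have qn0 : (q <= n0)%N.
  by rewrite -ltnS ltn_divLR //; move: i_n; rewrite -mulnSr mulnC.
exists (q + K)%N; first by rewrite /n1; clear -qn0; lia.
have qsep : 4 * eps1 <= mdist (iter q g (E a)) (iter q g (E b)).
  rewrite /eps1 invfM mulrCA mulVKf // ler_pdivrMr //.
  apply: le_trans isep _.
  rewrite (divn_eq i N) addnC !iterD -/q -!iter_iter -/g.
  apply: le_trans (iter_lipschitz (ltW L0) fL _ _ _) _.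
  rewrite mulrC ler_wpM2l ?mdist_ge0 //.
  by rewrite ler_weXn2l // ltnW // ltn_pmod.
have t1 := track _ _ _ za qn0; have t2 := track _ _ _ zb qn0.
have := metric_triangle (iter q g (E a)) (iter (q + K) g z) (iter q g (E b)).
have := metric_triangle (iter (q + K) g z) (iter (q + K) g z') (iter q g (E b)).
rewrite (metric_sym (iter (q + K) g z') (iter q g (E b))).
by lra.
Qed.

End tracking.

(** * Hits *)

Section hits.
Context {R : realType} {X : metricType R}.

(* The hit is aimed at time [n = N t + r]: the tracking block of [y] starts
   [a >= tau2 t / lambda1] steps before [t] and ends [b >= tau2 t / lambda2]
   steps after it, so that the error at time [t] is at most
   [eps0 * exp (- tau2 N t)]. *)
Lemma hit_exists (f : X -> X) (Y : set X) (N : nat)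
    (lambda1 lambda2 eps0 L tau1 tau2 c : R) (l : nat) (p : nat -> nat)
    (phi : nat -> R) :
  0 < lambda1 -> 0 < lambda2 -> 0 < eps0 -> (0 < N)%N ->
  1 <= L -> (forall x y, mdist (f x) (f y) <= L * mdist x y) ->
  iter N f @` Y = Y ->
  [set: X] = \bigcup_(l < N) (iter l f @` Y) ->
  limn_esup (fun n => ((p n)%:R / n%:R : R)%:E) = 0%E ->
  0 <= tau1 < tau2 -> 0 <= c ->
  c * (1 + tau2 / lambda2) < 1 - tau2 / lambda1 -> (0 < l)%N ->
  (forall r, (r < N)%N -> forall t0, exists2 t, (t0 <= t)%N &
     expR (- (tau1 * (N * t + r)%N%:R)) <= phi (N * t + r)%N) ->
  forall (y : X) (E : nat), exists (s e n len : nat) (v : X),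
    [/\ (E <= s < e)%N, c * e%:R <= s%:R - E%:R, (E <= n)%N,
        [/\ Y v, (0 < len)%N & (len + p len <= (e - s) * l)%N] &
        forall z, exp_bowen_ball Y (iter N f) len v eps0
            (N%:R * lambda1) (N%:R * lambda2) (iter (s * l) (iter N f) z) ->
          mdist (iter n f z) y <= phi n / 2].
Proof.
move=> l10 l20 eps00 N0 L1 fL fNY XY p0 /andP[tau10 tau12] c0 cA l0 hphi y E.
set g := iter N f.
have : [set: X] y by [].
rewrite XY => -[r /= rN [y' Yy' y'y]].
have L0 : 0 < L by lra.
have tau20 : 0 < tau2 by lra.
have N0' : (0 : R) < N%:R by rewrite ltr0n.
have l0' : (0 : R) < l%:R by rewrite ltr0n.
set Bq := tau2 / lambda2 in cA *; set Aq := tau2 / lambda1 in cA *.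
have Bq0 : 0 < Bq by rewrite divr_gt0.
have Aq0 : 0 < Aq by rewrite divr_gt0.
(* The slack in the hypothesis on [c]: one half will absorb the gap [p len], the other all
   constants. *)
pose gam := 1 - Aq - c * (1 + Bq).
have gam0 : 0 < gam by rewrite subr_gt0.
have Aq1 : 0 < 1 - Aq.
  have : 0 <= c * (1 + Bq) by rewrite mulr_ge0 //; lra.
  by move: gam0; rewrite /gam; lra.
pose Q := Bq + l%:R + 3.
have Q0 : 0 < Q by rewrite /Q; lra.
pose eta := gam / (2 * (c * Q + 1)).
have cQ0 : 0 <= c * Q by rewrite mulr_ge0 // ltW.
have eta0 : 0 < eta by rewrite divr_gt0 // mulr_gt0 //; lra.
have [M MP] := gap_small p0 eta0.
have a0 : 0 < (tau2 - tau1) * N%:R by rewrite mulr_gt0 // subr_gt0.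
have b0 : 0 < expR (- (tau1 * N%:R)) / 2 / L ^+ N.
  by rewrite !divr_gt0 ?expR_gt0 ?exprn_gt0.
(* For [t >= K] the difference [tau2 - tau1] absorbs three constants: [L ^+ N] for the last [r]
   steps, the factor 2 in [phi n / 2], and [expR (- (tau1 * N))] for passing from time [N t] to
   [N t + r]. *)
have [K [Kdecay|]] := expR_decay (expR (- (tau1 * N%:R)) / 2 / L ^+ N) a0 eps00;
  last by rewrite leNgt b0.
(* [t >= x1] makes the block long enough for the estimate of [p len]; [t >= x2] makes the rounding
   terms and [E] negligible against [gam * t / 2]. *)
pose x1 := M%:R / Bq.
pose x2 := (c * (2 + l%:R) + l%:R + E%:R * l%:R) / (gam / 2).
have [t t0t tphi] := hphi r rN (E + K + (Num.truncn x1).+1 + (Num.truncn x2).+1)%N.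
have Et : (E <= t)%N by clear -t0t; lia.
have Kt : (K <= t)%N by clear -t0t; lia.
have t1 : 1 <= t%:R :> R by rewrite ler1n; clear -t0t; lia.
have x1t : x1 <= t%:R.
  have tk : ((Num.truncn x1).+1 <= t)%N by clear -t0t; lia.
  by apply: ltW; apply: lt_le_trans (truncnS_gt x1) _; rewrite ler_nat.
have x2t : x2 <= t%:R.
  have tk : ((Num.truncn x2).+1 <= t)%N by clear -t0t; lia.
  by apply: ltW; apply: lt_le_trans (truncnS_gt x2) _; rewrite ler_nat.
have tR0 : 0 < t%:R :> R by lra.
(* Rounding down leaves at least [Aq * t] steps between the start of the block and time [t]. *)
pose s := Num.truncn ((1 - Aq) * t%:R / l%:R).
have [s_le s_gt] : s%:R * l%:R <= (1 - Aq) * t%:R /\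
    (1 - Aq) * t%:R <= s%:R * l%:R + l%:R.
  split.
    by rewrite -ler_pdivlMr // truncn_le divr_ge0 ?mulr_ge0 // ltW.
  rewrite -[X in _ <= _ + X]mul1r -mulrDl -ler_pdivrMr // natr1; exact/ltW/truncnS_gt.
have slt : (s * l <= t)%N.
  rewrite -(ler_nat R) natrM; apply: le_trans s_le _.
  by rewrite ler_piMl // ltW //; lra.
pose a := (t - s * l)%N.
have aE : a%:R = t%:R - s%:R * l%:R :> R by rewrite /a natrB // natrM.
have a_ge : Aq * t%:R <= a%:R by rewrite aE; lra.
pose b := (Num.truncn (Bq * t%:R)).+1.
have [b_ge b_le] : Bq * t%:R <= b%:R /\ b%:R <= Bq * t%:R + 1.
  split; first exact/ltW/truncnS_gt.
  by rewrite /b -natr1 lerD2r truncn_le mulr_ge0 // ltW.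
pose len := (a + b + 1)%N.
have lenE : len%:R = a%:R + b%:R + 1 :> R by rewrite /len !natrD.
have lenQ : len%:R <= Q * t%:R.
  rewrite lenE aE /Q.
  have : l%:R <= l%:R * t%:R :> R by rewrite ler_peMr // ltW.
  have : 0 <= Aq * t%:R by rewrite mulr_ge0 // ltW.
  have : 0 <= s%:R * l%:R :> R by rewrite mulr_ge0 ?ler0n.
  have := ltW l0'.
  by move: b_le t1; clear; lra.
have lenM : (M <= len)%N.
  rewrite -(ler_nat R); move: x1t; rewrite ler_pdivrMr // mulrC => /le_trans; apply.
  apply: le_trans b_ge _; rewrite ler_nat /len; clear; lia.
have plen : (p len)%:R <= eta * (Q * t%:R).
  by apply: le_trans (MP _ lenM) _; rewrite ler_wpM2l // ltW.
pose m := ((len + p len) %/ l)%N.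
pose e := (s + m.+1)%N.
have se : (s < e)%N by rewrite /e; clear; lia.
have lenp : (len + p len <= (e - s) * l)%N.
  by rewrite /e addKn ltnW // ltn_ceil.
have el : e%:R * l%:R <= t%:R + b%:R + 1 + (p len)%:R + l%:R :> R.
  have ml : m%:R * l%:R <= len%:R + (p len)%:R :> R.
    by rewrite -natrM -natrD ler_nat leq_trunc_div.
  have eE : e%:R = s%:R + m%:R + 1 :> R by rewrite /e addnS -natr1 natrD.
  rewrite eE !mulrDl mul1r.
  by move: ml; rewrite lenE aE; clear; lra.
have ce : c * e%:R <= s%:R - E%:R.
  rewrite -(ler_pM2r l0') mulrBl -mulrA.
  apply: le_trans (ler_wpM2l c0 el) _.
  have ceta : c * (eta * (Q * t%:R)) <= gam / 2 * t%:R.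
    have etaE : eta * (2 * (c * Q + 1)) = gam.
      by rewrite /eta divfK // lt0r_neq0 // mulr_gt0 //; lra.
    have -> : c * (eta * (Q * t%:R)) = eta * (c * Q) * t%:R by rewrite mulrCA !mulrA.
    rewrite ler_pM2r //; move: etaE eta0; move: (c * Q) => u; clear; lra.
  move: x2t; rewrite /x2 ler_pdivrMr; last by lra.
  rewrite !mulrDr => x2t.
  have h1 : c * b%:R <= c * (Bq * t%:R) + c.
    by rewrite -[X in _ + X]mulr1 -mulrDr ler_wpM2l.
  have h2 : c * (p len)%:R <= gam / 2 * t%:R.
    by apply: le_trans ceta; rewrite ler_wpM2l.
  have gamE : gam * t%:R = (1 - Aq) * t%:R - c * t%:R - c * (Bq * t%:R).
    by rewrite /gam mulrBl mulrDr mulr1 !mulrDl mulrA opprD addrA.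
  have h3 : t%:R * (gam / 2) = gam * t%:R / 2 by rewrite mulrA (mulrC t%:R).
  have h4 : gam / 2 * t%:R = gam * t%:R / 2 by rewrite mulrAC.
  move: s_gt h1 h2 x2t; rewrite h3 h4 gamE; clear; lra.
(* The tracked orbit reaches [y'] after [a] steps, which is [g]-time [t]; [r] further steps of [f]
   lead to [y]. *)
have [v Yv vE] := iter_image_id a fNY Yy'.
exists s, e, (N * t + r)%N, len, v; split => //.
- rewrite se andbT -(ler_nat R) -subr_ge0; apply: le_trans ce.
  by rewrite mulr_ge0.
- by apply: leq_trans Et _; clear -N0; nia.
- by split => //; rewrite /len addn1.
move=> z zv.
have tE : (a + s * l)%N = t by rewrite /a subnK.
have alen : (a < len)%N by rewrite /len; clear; lia.
have := exp_bowen_ball_tracks (kappa := N%:R * (tau2 * t%:R)) eps00 zv alen.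
rewrite -iterD tE vE => H.
apply: (@le_trans _ _ (expR (- (tau1 * (N * t + r)%N%:R)) / 2));
  last by rewrite ler_pM2r // invr_gt0.
rewrite -y'y [in iter _ _ _]addnC iterD mulnC -iter_iter metric_sym.
apply: le_trans (iter_lipschitz (ltW L0) fL _ _ _) _.
apply: (@le_trans _ _ (L ^+ N * (eps0 * expR (- (N%:R * (tau2 * t%:R)))))).
  rewrite ler_pM ?exprn_ge0 ?mdist_ge0 ?(ltW L0) //.
    by rewrite ler_weXn2l // ltnW.
  apply/ltW/H.
    by rewrite [leRHS]mulrCA ler_pM2l // -ler_pdivrMr // mulrAC.
  rewrite [leRHS]mulrCA ler_pM2l // -ler_pdivrMr // mulrAC.
  by rewrite (_ : (len.-1 - a)%N = b) // /len; clear; lia.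
have h1 : eps0 * expR (- (N%:R * (tau2 * t%:R))) =
   (eps0 * expR (- (t%:R * ((tau2 - tau1) * N%:R)))) * expR (- (tau1 * N%:R * t%:R)).
  by rewrite -mulrA -expRD; congr (_ * expR _); lra.
rewrite h1 mulrA.
have h2 : eps0 * expR (- (t%:R * ((tau2 - tau1) * N%:R))) <=
    expR (- (tau1 * N%:R)) / 2 / L ^+ N.
  apply: le_trans Kdecay; rewrite ler_pM2l // ler_expR lerN2 ler_pM2r //.
  by rewrite ler_nat.
rewrite ler_pdivlMr ?exprn_gt0 // mulrC in h2.
apply: le_trans (ler_wpM2r (expR_ge0 _) h2) _.
rewrite mulrAC -expRD ler_pM2r // ler_expR natrD natrM.
have : tau1 * r%:R <= tau1 * N%:R by rewrite ler_wpM2l // ler_nat ltnW.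
by clear; lra.
Qed.

End hits.

(* [compact_cover] is stated for pointed spaces. *)
Lemma compact_cover_point (T : topologicalType) (x0 : T) (A : set T) :
  compact A -> cover_compact A.
Proof.
pose T' : ptopologicalType := HB.pack T (isPointed.Build T x0).
move=> cA; have : @compact T' A by [].
by rewrite compact_cover.
Qed.

(** * Open sets, nets and dense sequences *)

Section metric_topology.
Context {R : realType} {X : metricType R}.

Lemma open_mdist_lt (x : X) (r : R) : open [set y | mdist x y < r].
Proof.
rewrite openE => y /= xy; apply/nbhs_ballP; exists (r - mdist x y) => /=.
  by rewrite subr_gt0.
move=> z; rewrite ballEmdist /= ltrBrDl; apply: le_lt_trans.
exact: metric_triangle.
Qed.

Lemma open_mdist_gt (x : X) (r : R) : open [set y | r < mdist x y].
Proof.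
rewrite openE => y /= xy; apply/nbhs_ballP; exists (mdist x y - r) => /=.
  by rewrite subr_gt0.
move=> z; rewrite ballEmdist /= => yz.
have := metric_triangle x z y; rewrite (metric_sym z y); lra.
Qed.

Lemma iter_continuous (f : X -> X) (k : nat) : continuous f -> continuous (iter k f).
Proof.
move=> fc; elim: k => [|k IHk] x; first exact: cvg_id.
by apply: (@continuous_comp _ _ _ (iter k f) f); [exact: IHk|exact: fc].
Qed.

Lemma open_bowen_ball (f : X -> X) n x eps : continuous f ->
  open (bowen_ball f n x eps).
Proof.
move=> fc.
elim: n => [|n IHn].
  rewrite (_ : bowen_ball _ _ _ _ = setT); first exact: openT.
  by apply/seteqP; split.
rewrite (_ : bowen_ball _ _ _ _ = bowen_ball f n x eps `&`
    (iter n f @^-1` [set y | mdist (iter n f x) y < eps])).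
  apply: openI => //; apply: open_comp; last exact: open_mdist_lt.
  by move=> ? _; exact: iter_continuous.
apply/seteqP; split => y /=.
  by move=> xy; split=> [i i_n|]; apply: xy => //; exact: ltnW.
move=> [xy yn] i; rewrite ltnS leq_eqVlt => /orP[/eqP->//|]; exact: xy.
Qed.

Lemma finite_net (r : R) : compact [set: X] -> [set: X] !=set0 -> 0 < r ->
  exists s : seq X, forall x, exists2 u, u \in s & mdist x u < r.
Proof.
move=> cX [x0 _] r0.
have [|x _|D _ DX] 
  := compact_cover_point x0 cX (D := setT) (f := fun u => [set y | mdist u y < r]).
- by move=> u _; exact: open_mdist_lt.
- by exists x => //=; rewrite mdistxx.
exists (finmap.enum_fset D) => x.
by have [u /= uD ux] := DX x I; exists u => //; rewrite metric_sym.
Qed.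

(** These are the targets of the hits. An index decodes to a triple whose first two entries select a
    net and a point of it; the third is ignored, so every net point recurs infinitely often. *)
Lemma recurrent_dense_sequence : compact [set: X] -> [set: X] !=set0 ->
  exists d : nat -> X, forall (x : X) (r : R), 0 < r ->
    exists2 y, mdist x y < r & forall M, exists2 j, (M <= j)%N & d j = y.
Proof.
move=> cX [x0 _].
have /choice[s sP] : forall k : nat, exists s : seq X,
    forall x, exists2 u, u \in s & mdist x u < k.+1%:R^-1.
  by move=> k; apply: finite_net; [|exists x0|rewrite invr_gt0 ltr0n].
exists (fun j : nat => if (choice.unpickle j : option (nat * nat * nat)) is Some (k, i, _)
  then nth x0 (s k) i else x0).
  move=> x r r0.
have [k kr] : exists k : nat, k.+1%:R^-1 < r.
  exists (Num.truncn r^-1); rewrite invf_plt ?posrE ?ltr0n //.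
  exact: truncnS_gt.
have [u us xu] := sP k x; exists u; first exact: lt_trans kr.
move=> M; have [|m mM] := @injective_gtn (fun m : nat => choice.pickle (k, index u (s k), m)) _ M.
  by move=> m m' /(pcan_inj choice.pickleK)[].
exists (choice.pickle (k, index u (s k), m)); first exact: ltnW.
by rewrite choice.pickleK nth_index.
Qed.

Lemma unbounded_infinite_set (A : set nat) :
  (forall M, exists2 n, (M <= n)%N & A n) -> infinite_set A.
Proof.
move=> Aub /finite_fsetP[D AD].
have [n Dn An] := Aub (\max_(i <- finmap.enum_fset D) i).+1.
have nD : n \in finmap.enum_fset D by move: An; rewrite AD.
by move: Dn; rewrite ltnNge leq_bigmax_seq.
Qed.

End metric_topology.

(** * Weight of open covers *)

Lemma card_cover_le (Om : finType) (r : seq nat) (B : nat -> {set Om}) :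
  (forall om, exists2 i, i \in r & om \in B i) ->
  (#|Om| <= \sum_(i <- r) #|B i|)%N.
Proof.
move=> cov; rewrite -sum1_card.
under [leqRHS]eq_bigr do rewrite -sum1_card big_mkcond /=.
rewrite exchange_big /=; apply: leq_sum => om _.
have [i ir omi] := cov om.
by rewrite (big_rem i) //= omi.
Qed.

(** The window is split at the origin [O]: on its left every cell counts, on its right only those
    marked by [b]. *)
Lemma card_window (O K mu nu : nat) (b : nat -> bool) :
  (mu <= O)%N -> (nu <= K)%N ->
  (mu + \sum_(0 <= a < nu) b a <=
   #|finset (fun a : 'I_(O + K) =>
      [&& O - mu <= a, a < O + nu & (a < O) || b (a - O)])|)%N.
Proof.
move=> muO nuK.
pose P a := [&& O - mu <= a, a < O + nu & (a < O) || b (a - O)]%N.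
have -> : #|finset (fun a : 'I_(O + K) => P a)| = (\sum_(0 <= a < O + K) P a)%N.
  by rewrite big_mkord -sum1_card big_mkcond; apply: eq_bigr => a _; rewrite finset.in_set; case: P.
set S := (\sum_(0 <= a < nu) b a)%N.
rewrite (big_cat_nat (n := (O - mu)%N)) ?(leq_trans (leq_subr _ _) (leq_addr _ _)) //=.
rewrite (big_cat_nat (n := O) (m := (O - mu)%N)) ?leq_subr ?leq_addr //=.
rewrite (big_cat_nat (n := (O + nu)%N) (m := O)) ?leq_addr ?leq_add2l //=.
have -> : (\sum_(O - mu <= a < O) P a = mu)%N.
  rewrite (eq_big_nat _ _ (F2 := fun=> 1%N)) => [|a aO].
    by rewrite sum_nat_const_nat muln1 subKn.
  suff -> : P a by [].
  by rewrite /P; case/andP: aO => -> aO; rewrite aO (leq_trans aO) ?leq_addr.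
have -> : (\sum_(O <= a < O + nu) P a = S)%N.
  rewrite (_ : \sum_(O <= a < O + nu) P a = \sum_(0 <= a < nu) P (a + O))%N.
    apply: eq_big_nat => a /andP[_ an].
    have aO : (O - mu <= a + O)%N by lia.
    by rewrite /P aO addnC ltn_add2l an ltnNge leq_addr addKn.
  have := big_addn (op := addn) (idx := 0%N) 0 (O + nu) O xpredT (fun a => P a : nat).
  by rewrite add0n addKn.
lia.
Qed.

Section covering.
Context {R : realType} {X : metricType R}.
Implicit Types (f : X -> X) (A : set nat).

(** The non-strict bound by [phi / 2] is a closed condition that still implies the strict bound by
    [phi]. A recurring target is hit at arbitrarily late times because [j <= nn j]. *)
Lemma hits_dense_covering f (phi : nat -> R) (d : nat -> X) (nn : nat -> nat) :
  (forall n, 0 < phi n) -> (forall j, (j <= nn j)%N) ->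
  (forall (x : X) (r : R), 0 < r -> exists2 y, mdist x y < r &
     forall M, exists2 j, (M <= j)%N & d j = y) ->
  [set x | forall j, mdist (iter (nn j) f x) (d j) <= phi (nn j) / 2] `<=`
    dense_covering_points f phi.
Proof.
move=> phi0 nn_ge dP x xd O [u Ou] Oop.
have /nbhs_ballP[r /= r0 rO] : nbhs u O by apply: open_nbhs_nbhs.
have [y uy yinf] := dP u r r0; exists y; split.
  by apply: rO; rewrite ballEmdist.
apply: unbounded_infinite_set => M; have [j Mj <-] := yinf M.
exists (nn j); first exact: leq_trans (nn_ge j).
apply: le_lt_trans (xd j) _.
by have := phi0 (nn j); lra.
Qed.

Lemma esum_seq_le (r : seq nat) A (a : nat -> R) :
  (forall i, 0 <= a i) -> uniq r -> {in r, forall i, A i} ->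
  ((\sum_(i <- r) a i)%:E <= \esum_(i in A) (a i)%:E)%E.
Proof.
move=> a0 ur rA; apply: esum_ge; exists [set` r].
  by split; [exact: finite_seq|move=> i /= /rA].
by rewrite -fsbig_seq // sumEFin.
Qed.

(** With [V j] the open set of points missing the [j]-th hit, the [U i] and [V j] together cover the
    whole compact space. A finite subcover involves finitely many [V j], so finitely many hits force
    a point into one of the chosen [U i]. *)
Lemma compact_finite_cover_hits (T : topologicalType) (x0 : T) A (U V : nat -> set T) :
  compact [set: T] -> (forall i, A i -> open (U i)) -> (forall j, open (V j)) ->
  \bigcap_j (~` V j) `<=` \bigcup_(i in A) U i ->
  exists (r : seq nat) (J : nat), [/\ uniq r, {in r, forall i, A i} &
    forall x, (forall j, (j < J)%N -> ~ V j x) -> exists2 i, i \in r & U i x].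
Proof.
move=> cT oU oV VU.
pose F (a : nat + nat) := match a with inl i => U i | inr j => V j end.
pose D := [set a : nat + nat | if a is inl i then A i else True].
have [||E ED Ecov] := compact_cover_point x0 cT (D := D) (f := F).
- by case=> [i|j] /=; [exact: oU|move=> _; exact: oV].
- move=> x _; have [[j Vjx]|noV] := pselect (exists j, V j x).
    by exists (inr j).
  have [i Ai Uix] : (\bigcup_(i in A) U i) x.
    by apply: VU => j _ Vjx; apply: noV; exists j.
  by exists (inl i).
pose e := finmap.enum_fset E.
pose lf (a : nat + nat) := if a is inl i then Some i else None.
pose rf (a : nat + nat) := if a is inr j then j else 0%N.
exists (undup (pmap lf e)), (\max_(a <- e) rf a).+1; split.
- exact: undup_uniq.
- move=> i; rewrite mem_undup mem_pmap => /mapP[[j|//] je [->]].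
  exact: (set_mem (ED _ je)).
- move=> x xV; have [[i|j] /= aE Fx] := Ecov x Logic.I.
    by exists i => //; rewrite mem_undup mem_pmap; apply/mapP; exists (inl i).
  exfalso; apply: xV Fx; rewrite ltnS.
  exact: (leq_bigmax_seq (inr j)).
Qed.

(** At [tau2 = tau] the last inequality is the hypothesis on [c] with denominators rearranged;
    strictness leaves room to increase [tau]. *)
Lemma entropy_factor_slack (lambda1 lambda2 tau c : R) :
  0 < lambda1 -> 0 < lambda2 -> 0 <= tau -> 0 <= c ->
  c < entropy_factor lambda1 lambda2 tau ->
  exists tau1 tau2, [/\ tau < tau1, tau1 < tau2 &
    c * (1 + tau2 / lambda2) < 1 - tau2 / lambda1].
Proof.
move=> l10 l20 tau0 c0.
have den0 : 0 < lambda1 * lambda2 + lambda1 * tau.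
  by rewrite -mulrDr mulr_gt0 // ltr_wpDr.
rewrite /entropy_factor ltr_pdivlMr // => cF.
pose gam := lambda1 * lambda2 - lambda2 * tau - c * (lambda1 * lambda2 + lambda1 * tau).
have gam0 : 0 < gam by rewrite subr_gt0.
have q0 : 0 < c * lambda1 + lambda2 by rewrite ltr_wpDl // mulr_ge0 // ltW.
(* Raising [tau] by [e] costs [e * (c * lambda1 + lambda2)], half of the slack. *)
pose e := gam / (2 * (c * lambda1 + lambda2)).
have e0 : 0 < e by rewrite divr_gt0 // mulr_gt0.
have eE : e * (c * lambda1 + lambda2) = gam / 2.
  by rewrite /e invfM mulrA divfK // lt0r_neq0.
exists (tau + e / 2), (tau + e); split; [by rewrite ltrDl divr_gt0|lra|].
have l12 : 0 < lambda1 * lambda2 by rewrite mulr_gt0.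
rewrite -(ltr_pM2r l12).
have -> : c * (1 + (tau + e) / lambda2) * (lambda1 * lambda2) =
   c * (lambda1 * lambda2 + lambda1 * (tau + e)).
  by field; rewrite lt0r_neq0.
have -> : (1 - (tau + e) / lambda1) * (lambda1 * lambda2) =
   lambda1 * lambda2 - lambda2 * (tau + e).
  by field; rewrite lt0r_neq0.
move: gam0 eE; rewrite /gam; clear; lra.
Qed.

(* The cover is tested on the points [f^(O l N) z], where [z] runs through a
   family of points whose free cells follow arbitrary words [om]; a set of the
   cover determines the word on every free cell inside its window
   [[O l N - m i, O l N + n i)]. *)
Lemma cover_weight_lower_bound f (Y : set X) (N : nat)
    (lambda1 lambda2 eps0 c h tau : R) (phi : nat -> R) :
  compact [set: X] -> continuous f -> (exists L : R, lipschitz_with L f) ->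
  Y !=set0 -> (0 < N)%N -> iter N f @` Y = Y ->
  [set: X] = \bigcup_(l < N) (iter l f @` Y) ->
  0 < lambda1 -> 0 < lambda2 -> 0 < eps0 ->
  exp_nonuniform_specification Y (iter N f)
    (N%:R * lambda1) (N%:R * lambda2) eps0 ->
  (forall n, 0 < phi n) -> 0 <= tau -> 0 <= c ->
  c < entropy_factor lambda1 lambda2 tau ->
  (forall tau1, tau < tau1 -> forall r, (r < N)%N -> forall t0,
     exists2 t, (t0 <= t)%N &
     expR (- (tau1 * (N * t + r)%N%:R)) <= phi (N * t + r)%N) ->
  h = 0 \/ 0 <= h /\ (h%:E < htop f [set: X])%E ->
  exists eps C : R, [/\ 0 < eps, 0 < C &
    forall A (U : nat -> set X) (m n : nat -> nat) (x : nat -> X),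
    (forall i, A i -> open (U i)) ->
    (forall i, A i -> forall z, U i (iter (m i) f z) ->
       forall k, (k < m i + n i)%N -> mdist (iter k f z) (iter k f (x i)) < eps) ->
    dense_covering_points f phi `<=` \bigcup_(i in A) U i ->
    (C%:E <= \esum_(i in A) (expR (- (h * ((m i)%:R + c * (n i)%:R))))%:E)%E].
Proof.
move=> cX fc [L0 fL0] Y0 N0 fNY XY l10 l20 eps00 [p [_ p0 spec]] phi0 tau0 c0 cF rate hh.
have h0 : 0 <= h by case: hh => [->|[]].
pose L := Num.max 1 L0.
have L1 : 1 <= L by rewrite le_max lexx.
have fL x y : mdist (f x) (f y) <= L * mdist x y.
  apply: le_trans (lipschitz_withP fL0 x y) _.
  by rewrite ler_wpM2r ?mdist_ge0 // le_max lexx orbT.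
have [tau1 [tau2 [t01 t12 ctau]]] := entropy_factor_slack l10 l20 tau0 c0 cF.
have tau10 : 0 <= tau1 < tau2 by rewrite t12 andbT; lra.
have tau2_0 : 0 < tau2 by lra.
have c1 : c <= 1.
  have : 0 <= tau2 / lambda1 by rewrite divr_ge0 ?ltW.
  have : 0 <= c * (tau2 / lambda2) by rewrite mulr_ge0 // divr_ge0 // ltW.
  by move: ctau; rewrite mulrDr mulr1; clear; lra.
have [eps [l [n1 [P [w [[e0 n10 P0 n1p] Yw Pbig sep]]]]]] :=
  block_exists l10 l20 eps00 N0 L1 fL Y0 fNY XY p0 hh.
have l0 : (0 < l)%N by apply: leq_trans n1p; rewrite ltn_addr.
have [x0 _] := Y0.
have [d dP] := recurrent_dense_sequence cX (ex_intro _ x0 I).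
have hits := hit_exists l10 l20 eps00 N0 L1 fL fNY XY p0 tau10 c0 ctau l0 (rate _ t01).
have /choice[H HP] : forall a : X * nat, exists b : nat * nat * nat * nat * X,
    [/\ (a.2 <= b.1.1.1.1 < b.1.1.1.2)%N,
        c * b.1.1.1.2%:R <= b.1.1.1.1%:R - a.2%:R, (a.2 <= b.1.1.2)%N,
        [/\ Y b.2, (0 < b.1.2)%N &
          (b.1.2 + p b.1.2 <= (b.1.1.1.2 - b.1.1.1.1) * l)%N] &
        forall z, exp_bowen_ball Y (iter N f) b.1.2 b.2 eps0
            (N%:R * lambda1) (N%:R * lambda2) (iter (b.1.1.1.1 * l) (iter N f) z) ->
          mdist (iter b.1.1.2 f z) a.1 <= phi b.1.1.2 / 2].
  move=> [y E]; have [s [e [n [len [v ?]]]]] := hits y E.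
  by exists (s, e, n, len, v).
(* Each hit is chosen after the end of the previous one is known. *)
pose E := fix E j := if j is j'.+1 then (H (d j', E j')).1.1.1.2 else 0%N.
pose b j := H (d j, E j); pose s j := (b j).1.1.1.1.
pose nn j := (b j).1.1.2; pose len j := (b j).1.2; pose v j := (b j).2.
have bP j := HP (d j, E j).
have Es j : (E j <= s j < E j.+1)%N by case: (bP j).
have Ec j : c * (E j.+1)%:R <= (s j)%:R - (E j)%:R by case: (bP j).
have En j : (E j <= nn j)%N by case: (bP j).
have Yv j : Y (v j) by case: (bP j) => _ _ _ [].
have len0 j : (0 < len j)%N by case: (bP j) => _ _ _ [].
have lenp j : (len j + p (len j) <= (E j.+1 - s j) * l)%N by case: (bP j) => _ _ _ [].
have hitP j z : exp_bowen_ball Y (iter N f) (len j) (v j) eps0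
            (N%:R * lambda1) (N%:R * lambda2) (iter (s j * l) (iter N f) z) ->
          mdist (iter (nn j) f z) (d j) <= phi (nn j) / 2.
  by case: (bP j) => _ _ _ _; apply.
have E0 : E 0%N = 0%N by [].
have free_count := free_cell_count E0 Es c0 c1 Ec.
clearbody s nn len v E; clear b bP H HP hits.
have NL0 : (0 < N * l)%N by rewrite muln_gt0 N0.
have NLR : (0 : R) < (N * l)%N%:R by rewrite ltr0n.
(* The constant pays for one incomplete cell of length [N * l] at each end of a window. *)
exists eps, (expR (- (2 * h * (N * l)%N%:R))); split; [by []|exact: expR_gt0|].
move=> A U m n x oU Uwin DU.
pose V j := iter (nn j) f @^-1` [set y | phi (nn j) / 2 < mdist (d j) y].
have oV j : open (V j).
  apply: open_comp; last exact: open_mdist_gt.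
  by move=> ? _; exact: iter_continuous.
have VU : \bigcap_j (~` V j) `<=` \bigcup_(i in A) U i.
  apply: subset_trans DU.
  apply: (subset_trans _ (hits_dense_covering phi0 _ dP)).
    move=> y yV j; rewrite metric_sym leNgt; apply/negP.
    exact: yV.
  by move=> j; apply: leq_trans (sched_ge E0 Es j) (En j).
have [r [J [ur rA rcov]]] := compact_finite_cover_hits x0 cX oU oV VU.
(* Enough cells on both sides of the origin to contain all windows of the finite subfamily and the
   first [J] hits. *)
pose O := \max_(i <- r) m i.
pose K := (maxn (\max_(i <- r) n i) (E J)).+1.
pose Om := {ffun 'I_(O + K) -> 'I_P}.
pose word (om : Om) (a : nat) : nat :=
  if insub a is Some i then nat_of_ord (om i) else 0%N.
have /choice[z zP] : forall om : Om, exists z, Y z /\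
    ((forall a, (a < O + K)%N -> (a < O)%N || free_cell s E (a - O) ->
       exp_bowen_ball Y (iter N f) n1 (w (word om a)) eps0
         (N%:R * lambda1) (N%:R * lambda2) (iter (a * l) (iter N f) z)) /\
    (forall j, (s j < K)%N ->
       exp_bowen_ball Y (iter N f) (len j) (v j) eps0
         (N%:R * lambda1) (N%:R * lambda2) (iter ((O + s j) * l) (iter N f) z))).
  move=> om.
  have [z Yz zP] := @layout s E E0 Es R X Y (iter N f) _ _ _ p l v len n1 w O K
    spec isT Yv Yw len0 n10 lenp n1p (word om).
  by exists z.
pose pt om := iter (O * l * N) f (z om).
have pt_cov om : exists2 i, i \in r & U i (pt om).
  apply: rcov => j jJ; apply/negP; rewrite -leNgt metric_sym.
  apply: hitP; rewrite /pt -(iter_iter f N (O * l)) -iterD -mulnDl addnC.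
  case: (zP om) => _ [_]; apply; rewrite ltnS leq_max; apply/orP; right.
  have EJ := sched_mono E0 Es jJ; apply: leq_trans EJ.
  by case/andP: (Es j) => _ /ltnW.
pose B i : {set Om} := finset (fun om => `[< U i (pt om) >]).
have card_le : (#|Om| <= \sum_(i <- r) #|B i|)%N.
  apply: card_cover_le => om; have [i ir Ui] := pt_cov om; exists i => //.
  by rewrite finset.in_set; apply/asboolP.
have OmE : #|{: Om}| = (P ^ (O + K))%N by rewrite card_ffun !card_ord.
have B_le i : i \in r -> (#|B i|)%:R <=
    expR (2 * h * (N * l)%N%:R) * expR (- (h * ((m i)%:R + c * (n i)%:R))) * #|Om|%:R.
  move=> ir; have Ai := rA _ ir.
  have mO : (m i <= O)%N by apply: leq_bigmax_seq.
  have nK : (n i <= K)%N.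
    by rewrite /K ltnW // ltnS leq_max leq_bigmax_seq.
  pose mu := (m i %/ (N * l))%N; pose nu := (n i %/ (N * l))%N.
  have muO : (mu <= O)%N by apply: leq_trans (leq_div _ _) mO.
  have nuK : (nu <= K)%N by apply: leq_trans (leq_div _ _) nK.
  pose F : {set 'I_(O + K)} :=
    finset (fun a : 'I_(O + K) => [&& O - mu <= a, a < O + nu &
       (a < O) || free_cell s E (a - O)]%N).
  (* Different blocks in a cell of the window would separate the orbits by [2 * eps], while both
     stay within [eps] of the orbit of [x i] there. *)
  have agree u u' a : u \in B i -> u' \in B i -> a \in F -> u a = u' a.
    rewrite !finset.in_set => /asboolP Uu /asboolP Uu' /and3P[a1 a2 a3].
    apply/eqP/negPn/negP => uu'.
    have aOK := ltn_ord a.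
    have wE (q : Om) : word q a = q a by rewrite /word valK.
    have [_ [/(_ _ aOK a3) + _]] := zP u; rewrite wE => bu.
    have [_ [/(_ _ aOK a3) + _]] := zP u'; rewrite wE => bu'.
    have [q qn1] := sep _ _ _ _ (ltn_ord (u a)) (ltn_ord (u' a)) uu' bu bu'.
    apply/negP; rewrite -ltNge -!iterD !iter_iter.
    have mu_le : (mu * (N * l) <= m i)%N by apply: leq_trunc_div.
    have nu_le : (nu * (N * l) <= n i)%N by apply: leq_trunc_div.
    have mOl : (m i <= O * l * N)%N.
      by apply: leq_trans mO _; rewrite -mulnA leq_pmulr // mulnC.
    have ql : (q < l)%N.
      by apply: leq_trans qn1 (leq_trans (leq_addr _ _) n1p).
    (* The separation time, counted from the left end of the window. *)
    pose k := ((q + a * l) * N - (O * l * N - m i))%N.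
    have k_ge : (O * l * N - m i <= (q + a * l) * N)%N.
      rewrite leq_subLR; apply: (@leq_trans ((mu + a) * (l * N))).
        by rewrite -mulnA leq_mul2r -leq_subLR a1 orbT.
      by rewrite mulnDl mulnDl (mulnC l) leq_add // mulnAC -mulnA mulnCA mulnA leq_addl.
    have k_lt : (k < m i + n i)%N.
      rewrite /k ltn_subLR // addnA subnK //.
      apply: (@leq_trans ((O + nu) * (l * N))).
        rewrite mulnA ltn_pmul2r //; apply: (@leq_trans (a.+1 * l)).
          by rewrite mulSn ltn_add2r.
        by rewrite leq_mul2r a2 orbT.
      by rewrite mulnDl mulnA leq_add2l (mulnC l).
    have kE : ((q + a * l) * N = k + (O * l * N - m i))%N by rewrite subnK.
    rewrite kE !iterD.
    have win u0 : U i (pt u0) -> mdist (iter k f (iter (O * l * N - m i) f (z u0)))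
        (iter k f (x i)) < eps.
      move=> Uu0; apply: (Uwin _ Ai) => //.
      by rewrite -iterD subnKC.
    have := win _ Uu; have := win _ Uu'.
    rewrite [X in X < _]metric_sym.
    have := metric_triangle (iter k f (iter (O * l * N - m i) f (z u)))
      (iter k f (x i)) (iter k f (iter (O * l * N - m i) f (z u'))).
    by lra.
  have := card_ffun_agree agree; rewrite !card_ord -OmE => BF.
  have Fge : ((mu + \sum_(0 <= a < nu) free_cell s E a) <= #|F|)%N.
    exact: card_window.
  have hF : h * ((m i)%:R + c * (n i)%:R) <=
      2 * h * (N * l)%N%:R + h * (N * l)%N%:R * #|F|%:R.
    have -> : 2 * h * (N * l)%N%:R + h * (N * l)%N%:R * #|F|%:R =
        h * (2 * (N * l)%N%:R + #|F|%:R * (N * l)%N%:R) by ring.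
    rewrite ler_wpM2l //.
    have m_le : (m i)%:R <= (mu%:R + 1) * (N * l)%N%:R :> R.
      by rewrite natr1 -natrM ler_nat ltnW // ltn_ceil.
    have n_le : (n i)%:R <= (nu%:R + 1) * (N * l)%N%:R :> R.
      by rewrite natr1 -natrM ler_nat ltnW // ltn_ceil.
    have F_le : mu%:R + c * nu%:R <= #|F|%:R.
      apply: (@le_trans _ _ (mu + \sum_(0 <= a < nu) free_cell s E a)%N%:R).
        by rewrite natrD lerD2l free_count.
      by rewrite ler_nat.
    have F_le' := ler_wpM2r (ltW NLR) F_le.
    have n_le' := ler_wpM2l c0 n_le.
    have c_le := ler_wpM2r (ltW NLR) c1.
    by move: m_le n_le' F_le' c_le; clear; lra.
  have PF : expR (h * (N * l)%N%:R * #|F|%:R) <= P%:R ^+ #|F|.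
    by rewrite expRM_natr lerXn2r ?nnegrE ?expR_ge0 ?ler0n.
  have PF0 : 0 < P%:R ^+ #|F| :> R by rewrite exprn_gt0 // ltr0n.
  rewrite -(ler_pM2r PF0) -natrX -natrM.
  apply: (@le_trans _ _ #|Om|%:R); first by rewrite ler_nat.
  rewrite mulrAC ler_peMl ?ler0n // natrX.
  apply: le_trans (ler_wpM2l _ PF); last by rewrite mulr_ge0 ?expR_ge0.
  by rewrite -!expRD -[leLHS]expR0 ler_expR; move: hF; clear; lra.
(* Every word lies in some [B i]; dividing by the number of words gives the bound on the weight. *)
have Om0 : (0 : R) < #|Om|%:R by rewrite ltr0n OmE expn_gt0 P0.
apply: le_trans (esum_seq_le _ ur rA); last by move=> i; exact: expR_ge0.
rewrite lee_fin expRN -[leLHS]mul1r ler_pdivrMr ?expR_gt0 // -(ler_pM2r Om0) mul1r.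
rewrite !mulr_suml; apply: (@le_trans _ _ (\sum_(i <- r) #|B i|%:R)).
  by rewrite -natr_sum ler_nat.
rewrite big_seq [leRHS]big_seq; apply: ler_sum => i ir.
by apply: le_trans (B_le i ir) _; rewrite (mulrC (expR (2 * _ * _))).
Qed.

End covering.

(** * Hausdorff dimension *)

Section hausdorff.
Context {R : realType} {X : metricType R}.
Implicit Types (Z : set X) (A : set nat).

Lemma esum_le_finite_sums A (a : nat -> R) (C : \bar R) :
  (forall i, 0 <= a i) ->
  (forall r : seq nat, uniq r -> {in r, forall i, A i} ->
     ((\sum_(i <- r) a i)%:E <= C)%E) ->
  (\esum_(i in A) (a i)%:E <= C)%E.
Proof.
move=> a0 H; apply: ge_ereal_sup => _ [F [finF FA] <-].
have [D FD] := finite_fsetP.1 finF; rewrite FD in FA *.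
rewrite -[[set` D]]/[set` enum_fset D] -fsbig_seq ?fset_uniq // sumEFin.
by apply: H; [exact: fset_uniq|move=> i /FA].
Qed.

Lemma sum_half_powers (r : seq nat) (e : R) : uniq r -> 0 <= e ->
  \sum_(i <- r) e / (2 ^ i.+1)%:R <= e.
Proof.
move=> ur e0; rewrite -lee_fin.
have a0 i : 0 <= e / (2 ^ i.+1)%:R by rewrite divr_ge0.
apply: le_trans (esum_seq_le (A := setT) a0 ur _) _ => //.
rewrite -nneseries_esumT; last by move=> i; rewrite lee_fin.
exact: epsilon_trick0.
Qed.

Lemma powRD_le (q x y : R) : 0 < q -> 0 <= x -> 0 <= y ->
  (x + y) `^ q <= 2 `^ q * (x `^ q + y `^ q).
Proof.
move=> q0; wlog xy : x y / x <= y => [H x0 y0|x0 y0].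
  have [/H->//|/ltW/H] := leP x y.
  by rewrite addrC [y `^ q + _]addrC; apply.
apply: (@le_trans _ _ ((2 * y) `^ q)).
  rewrite ge0_ler_powR ?nnegrE ?(ltW q0) ?addr_ge0 ?mulr_ge0 //.
  by rewrite mulr_natl mulr2n lerD2r.
by rewrite powRM // ler_wpM2l ?powR_ge0 // lerDr powR_ge0.
Qed.

Lemma hausdorff_premeasure_le_measure Z s delta : 0 < delta ->
  (hausdorff_premeasure Z s delta <= hausdorff_measure Z s)%E.
Proof.
move=> d0; have -> : hausdorff_measure Z s = ereal_sup
    (hausdorff_premeasure Z s @` [set` Interval (BRight 0) (BInfty R false)]).
  apply/cvg_lim => //.
  apply: (nonincreasing_at_right_cvge (BInfty R false)) => // e e' _ _ ee'.
  apply: ereal_inf_le_tmp => _ [A [U [Ud ZU ->]]].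
  exists A, U; split => // i /Ud Ui; apply: le_trans Ui _.
  by rewrite lee_fin.
by apply: ereal_sup_ubound; exists delta => //=; rewrite in_itv /= d0.
Qed.

Lemma hausdorff_dim_ge0 Z : (0 <= hausdorff_dim Z)%E.
Proof. by apply: le_ereal_inf_tmp => _ [s [s0 _] <-]; rewrite lee_fin. Qed.

Lemma fine_diam_ge0 Z : 0 <= fine (diam Z).
Proof.
have [->|/set0P[x Zx]] := eqVneq Z set0.
  rewrite /diam (_ : [set _ | _ in _] = set0) ?ereal_sup0 //.
  by apply/seteqP; split => // _ [? [[]]].
apply: fine_ge0; apply: ereal_sup_ubound; exists (x, x) => //=.
by rewrite mdistxx.
Qed.

Lemma mdist_le_fine_diam Z delta x y : (diam Z <= delta%:E)%E -> Z x -> Z y ->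
  mdist x y <= fine (diam Z).
Proof.
move=> Zd Zx Zy.
have xy : ((mdist x y)%:E <= diam Z)%E by apply: ereal_sup_ubound; exists (x, y).
rewrite -lee_fin fineK // fin_numE.
by move: xy Zd; case: diam.
Qed.

(* Each set [U i] of a cover is replaced by a ball around one of its points
   whose radius exceeds the diameter by a summable error, so that only covers
   by balls have to be considered. *)
Lemma hausdorff_dim_ge Z (q C r0 : R) :
  Z !=set0 -> 0 < q -> 0 < C -> 0 < r0 ->
  (forall A (u : nat -> X) (rho : nat -> R), (forall i, A i -> 0 < rho i < r0) ->
     Z `<=` \bigcup_(i in A) [set y | mdist (u i) y < rho i] ->
     (C%:E <= \esum_(i in A) (rho i `^ q)%:E)%E) ->
  (q%:E <= hausdorff_dim Z)%E.
Proof.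
move=> [z Zz] q0 C0 r00 cov; apply: le_ereal_inf_tmp => _ [s [s0 Hs] <-].
rewrite lee_fin leNgt; apply/negP => sq.
pose c1 := C / 2 `^ q / 4.
have two_q : 0 < 2 `^ q :> R by rewrite powR_gt0.
have c10 : 0 < c1 by rewrite !divr_gt0.
(* Diameters at most 1 allow passing from exponent [s] to the larger [q]; [r0 / 2] and an error of
   [r0 / 3] stay below [r0]. *)
have delta0 : 0 < Num.min 1 (r0 / 2) by rewrite lt_min ltr01 divr_gt0.
have [_ [A [U [Ud ZU ->]]] sumU] : exists2 v : \bar R,
  [set v | exists (A : set nat) (U : nat -> set X), [/\ forall i, A i -> (diam (U i) <= (Num.min 1 (r0 / 2))%:E)%E,
        Z `<=` \bigcup_(i in A) U i &
        v = \esum_(i in A) (fine (diam (U i)) `^ s)%:E]] v & (v < c1%:E)%E.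
  apply/ereal_inf_lt/(le_lt_trans (hausdorff_premeasure_le_measure _ _ delta0)).
  by rewrite Hs lte_fin.
pose D i := fine (diam (U i)).
have D0 i : 0 <= D i by apply: fine_diam_ge0.
have /choice[u uU] : forall i, exists u, U i !=set0 -> U i u.
  move=> i; have [[u Uu]|noU] := pselect (U i !=set0); first by exists u.
  by exists z.
pose eta i := Num.min (r0 / 3) ((c1 / (2 ^ i.+1)%:R) `^ q^-1).
have e0 i : 0 < c1 / (2 ^ i.+1)%:R by rewrite divr_gt0 // ltr0n expn_gt0.
have eta0 i : 0 < eta i by rewrite lt_min divr_gt0 // powR_gt0.
have eta_q i : eta i `^ q <= c1 / (2 ^ i.+1)%:R.
  apply: (@le_trans _ _ (((c1 / (2 ^ i.+1)%:R) `^ q^-1) `^ q)).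
    by rewrite ge0_ler_powR ?nnegrE ?(ltW q0) ?(ltW (eta0 i)) ?powR_ge0 // ge_min lexx orbT.
  by rewrite -powRrM mulVf ?lt0r_neq0 // powRr1 // ltW.
have D_le i : A i -> D i <= Num.min 1 (r0 / 2).
  move=> /Ud Ui; rewrite /D; case: (diam (U i)) Ui => [d| |] //= _.
  exact: ltW.
have D_q i : A i -> D i `^ q <= D i `^ s.
  move=> /D_le; rewrite le_min => /andP[D1 _].
  have := D0 i; rewrite le_eqVlt => /orP[/eqP <-|Di].
    by rewrite powR0 ?lt0r_neq0 // powR_ge0.
  by apply: ger_powR; [rewrite Di|exact: ltW].
suff : (C%:E <= (2 `^ q * (c1 + c1))%:E)%E.
  rewrite lee_fin; apply/negP; rewrite -ltNge /c1.
  have -> : 2 `^ q * (C / 2 `^ q / 4 + C / 2 `^ q / 4) = C / 2.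
    by field; rewrite lt0r_neq0.
  by move: C0; clear; lra.
apply: le_trans (cov A u (fun i => D i + eta i) _ _) _.
- move=> i Ai; rewrite ltr_wpDl //=.
  have := D_le _ Ai; rewrite le_min => /andP[_ Dr].
  have : eta i <= r0 / 3 by rewrite ge_min lexx.
  by move: Dr r00; clear; lra.
- move=> y /ZU[i Ai Uy]; exists i => //=.
  apply: (@le_lt_trans _ _ (D i)); last by rewrite ltrDl.
  apply: (mdist_le_fine_diam (Ud _ Ai)) => //.
  by apply: uU; exists y.
apply: esum_le_finite_sums => [i|r ur rA]; first exact: powR_ge0.
rewrite lee_fin.
apply: (@le_trans _ _ (\sum_(i <- r) 2 `^ q * (D i `^ s + c1 / (2 ^ i.+1)%:R))).
  rewrite big_seq [leRHS]big_seq; apply: ler_sum => i ir.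
  apply: le_trans (powRD_le q0 (D0 i) (ltW (eta0 i))) _.
  by rewrite ler_pM2l // lerD // D_q //; apply: rA.
rewrite -mulr_sumr ler_pM2l // big_split lerD //; last first.
  by apply: sum_half_powers => //; exact: ltW.
rewrite -lee_fin; apply/ltW/(le_lt_trans _ sumU).
by apply: esum_seq_le => // i; exact: powR_ge0.
Qed.

End hausdorff.

(** * Conclusions *)

Section conclusions.
Context {R : realType}.

Lemma truncn_lbound (x : R) : x <= (Num.truncn x)%:R + 1.
Proof. by rewrite natr1 ltW // truncnS_gt. Qed.

(** A passage to the limit [c -> kappa], [h -> H], since the covering estimates hold only strictly
    below the entropy factor and the entropy. *)
Lemma le_mul_of_lt (alpha beta kappa : R) (H T : \bar R) :
  0 <= alpha -> 0 <= beta -> 0 < kappa -> (0 <= H)%E -> (0 <= T)%E ->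
  (forall c h, 0 <= c -> c < kappa -> 0 <= h -> (h%:E < H)%E ->
     (((alpha + beta * c) * h)%:E <= T)%E) ->
  ((alpha + beta * kappa)%:E * H <= T)%E.
Proof.
move=> a0 b0 k0 H0 T0 lt_le.
have ab0 : 0 <= alpha + beta * kappa by rewrite addr_ge0 // mulr_ge0 // ltW.
have [->|ab_neq0] := eqVneq (alpha + beta * kappa) 0; first by rewrite mul0e.
have ab_gt0 : 0 < alpha + beta * kappa by rewrite lt_neqAle eq_sym ab_neq0.
case: T T0 lt_le => [t| |] // t0 lt_le; last by rewrite leey.
rewrite lee_fin in t0.
case: H H0 lt_le => [H| |] // H0 lt_le; last first.
  (* With [H] infinite, [h = (t + 1) / q] at [c = kappa / 2] contradicts the bound [t]. *)
  exfalso; pose q := alpha + beta * (kappa / 2).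
  have q0 : 0 < q.
    rewrite /q mulrA; move: ab_gt0 a0; set bk := beta * kappa.
    have : 0 <= bk by rewrite /bk mulr_ge0 // ltW.
    by clear; lra.
  have := lt_le (kappa / 2) ((t + 1) / q).
  rewrite lee_fin mulrCA divff ?lt0r_neq0 // mulr1 ltry => /(_ _ _ _ isT).
  suff : ~~ (t + 1 <= t).
    move=> /negP nt /(_ _ _ _)/nt; apply.
    - by rewrite divr_ge0 // ltW.
    - by move: k0; clear; lra.
    - by rewrite divr_ge0 ?ltW // ltr_wpDl.
  by rewrite -ltNge ltrDl.
rewrite lee_fin in H0; rewrite -EFinM lee_fin leNgt; apply/negP => tX.
pose Y := (alpha + beta * kappa) * H.
have Y0 : 0 < Y by apply: le_lt_trans tX.
have H_gt0 : 0 < H by move: Y0; rewrite pmulr_rgt0.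
(* The mean of 1 and [u = t / Y] has a square exceeding [u], because [(1 - u)^2 > 0]. *)
pose theta := (1 + t / Y) / 2.
have tY : t / Y < 1 by rewrite ltr_pdivrMr // mul1r.
have tY0 : 0 <= t / Y by rewrite divr_ge0 // ltW.
have th0 : 0 < theta by rewrite /theta; move: tY0; clear; lra.
have th1 : theta < 1 by rewrite /theta; move: tY; clear; lra.
have := lt_le (theta * kappa) (theta * H).
rewrite lte_fin lee_fin => /(_ _ _ _ _) le_t.
have : (alpha + beta * (theta * kappa)) * (theta * H) <= t.
  apply: le_t.
  - by rewrite mulr_ge0 // ltW.
  - by rewrite gtr_pMl.
  - by rewrite mulr_ge0 // ltW.
  - by rewrite gtr_pMl.
apply/negP; rewrite -ltNge.
apply: (@lt_le_trans _ _ (theta * theta * Y)).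
  rewrite -ltr_pdivrMr // /theta; move: tY; set u := t / Y.
  by clear; nra.
have -> : theta * theta * Y = theta * (alpha + beta * kappa) * (theta * H).
  by rewrite /Y; ring.
apply: ler_wpM2r; first by rewrite mulr_ge0 // ltW.
rewrite mulrDr lerD //.
  by rewrite ler_piMl // ltW.
by rewrite mulrCA.
Qed.

Section rates.
Variable phi : nat -> R.
Hypothesis phi01 : forall n, 0 < phi n <= 1.

Lemma decay_rate_ge0 n : 0 <= - ln (phi n) / n%:R.
Proof. by rewrite divr_ge0 // oppr_ge0 ln_le0 //; case/andP: (phi01 n). Qed.

Lemma decay_rate_lt n tau : (0 < n)%N -> - ln (phi n) / n%:R < tau ->
  expR (- (tau * n%:R)) <= phi n.
Proof.
move=> n0; rewrite ltr_pdivrMr ?ltr0n // => lt_tau.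
have /andP[p0 _] := phi01 n.
rewrite -[leRHS]lnK ?posrE // ler_expR.
by move: lt_tau; clear; lra.
Qed.

Lemma upper_rate_ge0 : (0 <= upper_rate phi)%E.
Proof.
rewrite leNgt; apply/negP => /limn_esup_lt_near[M /(_ _ (leqnn M))].
by apply/negP; rewrite -leNgt lee_fin decay_rate_ge0.
Qed.

Lemma lower_rate_ge0 : (0 <= lower_rate phi)%E.
Proof.
rewrite leNgt; apply/negP => /limn_einf_lt_frequently/(_ 0%N)[n _].
by apply/negP; rewrite -leNgt lee_fin decay_rate_ge0.
Qed.

(** The upper limit controls all late times, hence every residue class modulo [N]; targets in
    [f^r(Y)] require times congruent to [r]. *)
Lemma upper_rate_hits (N : nat) (tau1 : R) : (0 < N)%N ->
  (upper_rate phi < tau1%:E)%E ->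
  forall r, (r < N)%N -> forall t0, exists2 t, (t0 <= t)%N &
     expR (- (tau1 * (N * t + r)%N%:R)) <= phi (N * t + r)%N.
Proof.
move=> N0 /limn_esup_lt_near[M MP] r rN t0.
exists (t0 + M + 1)%N; first by rewrite -addnA leq_addr.
have tN : (t0 + M + 1 <= N * (t0 + M + 1) + r)%N.
  by rewrite (leq_trans (leq_pmull _ N0)) ?leq_addr.
apply: decay_rate_lt; first by move: tN; clear; lia.
by rewrite -lte_fin; apply: MP; move: tN; clear; lia.
Qed.

(** The lower limit controls infinitely many times but not their residues, hence the restriction to
    [N = 1]. *)
Lemma lower_rate_hits (tau1 : R) :
  (lower_rate phi < tau1%:E)%E ->
  forall r, (r < 1)%N -> forall t0, exists2 t, (t0 <= t)%N &
     expR (- (tau1 * (1 * t + r)%N%:R)) <= phi (1 * t + r)%N.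
Proof.
move=> tau1_lt r; rewrite ltnS leqn0 => /eqP-> t0.
have [n t0n nP] := limn_einf_lt_frequently tau1_lt t0.+1.
exists n; first exact: ltnW.
rewrite addn0 mul1n; apply: decay_rate_lt; first exact: leq_trans t0n.
by rewrite -lte_fin.
Qed.

End rates.

Section dynamics.
Variables (X : metricType R) (f : X -> X).

(** One finite net covers by Bowen balls of every length, with weight tending to 0 for each positive
    exponent. *)
Lemma htop_nonexpanding : compact [set: X] -> [set: X] !=set0 ->
  (forall x y, mdist (f x) (f y) <= mdist x y) -> htop f [set: X] = 0%E.
Proof.
move=> cX X0 f1; apply/eqP; rewrite eq_le htop_ge0 andbT htopE.
apply: ge_ereal_sup => _ [eps /= + <-]; rewrite in_itv /= andbT => eps0.
apply/lee_addgt0Pr => s s0; rewrite add0e; apply: ereal_inf_lbound.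
exists s => //; split; first exact: ltW.
apply/eqP; rewrite eq_le; apply/andP; split; last first.
  by apply: le_trans (bowen_premeasure_le_measure _ _ _ 0%N _);
    apply: bowen_premeasure_ge0.
rewrite bowen_measureE; apply: ge_ereal_sup => _ [M _ <-].
apply/lee_addgt0Pr => e e0; rewrite add0e.
have [r rP] := finite_net cX X0 eps0.
have [x0 _] := X0.
have r0 : 0 < (size r)%:R :> R.
  have [u ur _] := rP x0; rewrite ltr0n.
  by case: r ur {rP}.
have [K [KP|]] := expR_decay e s0 r0; last by rewrite leNgt e0.
apply: ereal_inf_le; exists ((size r)%:R * expR (- (s * (M + K)%N%:R)))%:E.
  exists [set i | (i < size r)%N], (nth x0 r), (fun=> (M + K)%N); split.
  - by move=> i _; rewrite leq_addr.
  - move=> y _; have [u ur yu] := rP y; exists (index u r) => /=.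
      by rewrite index_mem.
    rewrite nth_index // => i _; rewrite metric_sym in yu.
    apply: le_lt_trans yu; elim: i => //= i IHi.
    exact: le_trans (f1 _ _) IHi.
  - by rewrite esum_const_ltn // expR_ge0.
rewrite lee_fin; apply: le_trans KP; rewrite ler_pM2l // ler_expR lerN2.
by rewrite mulrC ler_pM2l // ler_nat leq_addl.
Qed.

(** The bound on [k] comes from solving [L ^ k * rho = eps]. *)
Lemma iter_mdist_lt (g : X -> X) (L eps rho : R) (x y : X) (k : nat) :
  1 < L -> 0 < rho < eps -> (forall x y, mdist (g x) (g y) <= L * mdist x y) ->
  (k <= Num.truncn (ln (eps / rho) / ln L))%N ->
  mdist x y < rho -> mdist (iter k g x) (iter k g y) < eps.
Proof.
move=> L1 /andP[rho0 re] gL kn xy.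
have L0 : 0 < L by apply: lt_trans L1.
have lnL : 0 < ln L by apply: ln_gt0.
apply: le_lt_trans (iter_lipschitz (ltW L0) gL _ _ _) _.
apply: (@lt_le_trans _ _ (L ^+ k * rho)).
  by rewrite ltr_pM2l // exprn_gt0.
rewrite -ler_pdivlMr //.
have er0 : 0 < eps / rho by rewrite divr_gt0 // (lt_trans rho0).
rewrite -[leLHS]lnK ?posrE ?exprn_gt0 // -[leRHS]lnK ?posrE // ler_expR.
rewrite lnXn // -mulr_natl -ler_pdivlMr //.
rewrite -truncn_ge_nat // divr_ge0 ?(ltW lnL) // ln_ge0 //.
by rewrite ler_pdivlMr // mul1r ltW.
Qed.

Variables (Y : set X) (N : nat) (lambda1 lambda2 eps0 tau : R) (phi : nat -> R).
Hypotheses (cX : compact [set: X]) (fc : continuous f)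
  (flip : exists L : R, lipschitz_with L f)
  (Y0 : Y !=set0) (N0 : (0 < N)%N) (fNY : iter N f @` Y = Y)
  (XY : [set: X] = \bigcup_(l < N) (iter l f @` Y))
  (lambda1_gt0 : 0 < lambda1) (lambda2_gt0 : 0 < lambda2) (eps0_gt0 : 0 < eps0)
  (Yspec : exp_nonuniform_specification Y (iter N f)
             (N%:R * lambda1) (N%:R * lambda2) eps0)
  (phi0 : forall n, 0 < phi n) (tau0 : 0 <= tau) (tau1 : tau < lambda1)
  (rate : forall tau1, tau < tau1 -> forall r, (r < N)%N -> forall t0,
     exists2 t, (t0 <= t)%N &
     expR (- (tau1 * (N * t + r)%N%:R)) <= phi (N * t + r)%N).

Let D := dense_covering_points f phi.
Let kappa := entropy_factor lambda1 lambda2 tau.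

Lemma entropy_factor_gt0 : 0 < kappa.
Proof.
rewrite /kappa /entropy_factor divr_gt0 //.
  by rewrite mulrC -mulrBr mulr_gt0 // subr_gt0.
by rewrite -mulrDr mulr_gt0 // ltr_wpDr.
Qed.

Let cover_weight c h c0 ck hh := @cover_weight_lower_bound R X f Y N lambda1
  lambda2 eps0 c h tau phi cX fc flip Y0 N0 fNY XY lambda1_gt0 lambda2_gt0
  eps0_gt0 Yspec phi0 tau0 c0 ck rate hh.

(** Otherwise the empty family would be a cover, of weight 0 < [C]. *)
Lemma dense_covering_points_nonempty : D !=set0.
Proof.
have [eps [C [_ C0 cov]]] := @cover_weight 0 0 (lexx 0) entropy_factor_gt0 (or_introl erefl).
have [x0 _] := Y0.
apply/set0P/eqP => D0.
have := cov set0 (fun=> setT) (fun=> 0%N) (fun=> 0%N) (fun=> x0).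
rewrite esum_set0 lee_fin leNgt C0 => H.
suff : false by [].
by apply: H => //; rewrite -/D D0.
Qed.

(** Bowen balls are windows with [m = 0], so for an exponent below [c * h] every cover has weight at
    least [C]. *)
Lemma htop_dense_covering_points :
  (kappa%:E * htop f [set: X] <= htop f D)%E.
Proof.
have := @le_mul_of_lt 0 1 kappa (htop f [set: X]) (htop f D) (lexx 0) ler01
  entropy_factor_gt0 (htop_ge0 _ _) (htop_ge0 _ _).
rewrite add0r mul1r; apply.
move=> c h c0 ck h0 hH; rewrite add0r mul1r.
have [eps [C [e0 C0 cov]]] := @cover_weight c h c0 ck (or_intror (conj h0 hH)).
apply: le_trans (htop_scale_le_htop _ _ e0).
apply: le_ereal_inf_tmp => _ [s [s0 sM] <-].
rewrite lee_fin leNgt; apply/negP => sch.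
suff : (C%:E <= bowen_measure f D s eps)%E by rewrite sM lee_fin leNgt C0.
apply: le_trans (bowen_premeasure_le_measure _ _ _ 0%N _).
apply: le_ereal_inf_tmp => _ [A [x [n [_ Dcov ->]]]].
apply: le_trans (cov A (fun i => bowen_ball f (n i) (x i) eps) (fun=> 0%N) n x _ _ Dcov) _.
- by move=> i _; exact: open_bowen_ball.
- by move=> i _ z /= zx k kn; rewrite metric_sym; apply: zx.
apply: le_esum => i _; rewrite lee_fin ler_expR lerN2 add0r mulrA.
by rewrite ler_wpM2r // mulrC ltW.
Qed.

Lemma hausdorff_dim_dense_covering_points (alpha beta : R) :
  0 <= alpha -> 0 <= beta ->
  (forall (eps rho : R) (u : X), 0 < rho < eps -> exists (m n : nat) (x : X),
     [/\ alpha * ln (eps / rho) <= m%:R + 1, beta * ln (eps / rho) <= n%:R + 1 &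
      forall z, mdist u (iter m f z) < rho ->
        forall k, (k < m + n)%N -> mdist (iter k f z) (iter k f x) < eps]) ->
  ((alpha + beta * kappa)%:E * htop f [set: X] <= hausdorff_dim D)%E.
Proof.
move=> a0 b0 win.
apply: (@le_mul_of_lt alpha beta kappa _ _ a0 b0 entropy_factor_gt0
  (htop_ge0 _ _) (hausdorff_dim_ge0 _)).
move=> c h c0 ck h0 hH.
have [eps [C [e0 C0 cov]]] := @cover_weight c h c0 ck (or_intror (conj h0 hH)).
set q := (alpha + beta * c) * h.
have q0 : 0 <= q by rewrite mulr_ge0 // addr_ge0 // mulr_ge0.
have [->|q_neq0] := eqVneq q 0; first exact: hausdorff_dim_ge0.
have q_gt0 : 0 < q by rewrite lt_neqAle eq_sym q_neq0.
(* The first factor compensates the [+ 1] in both window lengths, the second the scale [eps]. *)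
pose B := expR (h * (1 + c)) / eps `^ q.
have B0 : 0 < B by rewrite divr_gt0 ?expR_gt0 ?powR_gt0.
apply: (@hausdorff_dim_ge R X D q (C / B) eps dense_covering_points_nonempty q_gt0) => //.
  by rewrite divr_gt0.
move=> A u rho rho0 Dcov.
have /choice[w wP] : forall i, exists w : nat * nat * X, A i ->
    [/\ alpha * ln (eps / rho i) <= w.1.1%:R + 1,
        beta * ln (eps / rho i) <= w.1.2%:R + 1 &
      forall z, mdist (u i) (iter w.1.1 f z) < rho i ->
        forall k, (k < w.1.1 + w.1.2)%N -> mdist (iter k f z) (iter k f w.2) < eps].
  move=> i; have [Ai|nAi] := pselect (A i); last by exists (0%N, 0%N, u i).
  by have [m [n [x mnP]]] := win _ _ (u i) (rho0 _ Ai); exists (m, n, x).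
have := cov A (fun i => [set y | mdist (u i) y < rho i])
  (fun i => (w i).1.1) (fun i => (w i).1.2) (fun i => (w i).2) _ _ Dcov.
move=> /(_ _ _)covA.
have {}covA : (C%:E <= \esum_(i in A) (expR (- (h * ((w i).1.1%:R + c * (w i).1.2%:R))))%:E)%E.
  apply: covA => i Ai; first exact: open_mdist_lt.
  by case: (wP _ Ai).
have : (C%:E <= \esum_(i in A) (B * rho i `^ q)%:E)%E.
  apply: le_trans covA _; apply: le_esum => i Ai; rewrite lee_fin.
  have /andP[r0 re] := rho0 _ Ai.
  have [hm hn _] := wP _ Ai.
  have -> : B * rho i `^ q = expR (h * (1 + c) - q * ln (eps / rho i)).
    rewrite /B expRD expRN -mulrA; congr (_ * _).
    rewrite ln_div ?posrE // mulrBr expRB invf_div /powR !gt_eqF // mulrC.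
    by [].
  rewrite ler_expR.
  have hm' := ler_wpM2l h0 hm.
  have hn' := ler_wpM2l (mulr_ge0 h0 c0) hn.
  rewrite /q; move: hm' hn'; set l := ln _; set m := (w i).1.1%:R; set n := (w i).1.2%:R.
  by lra.
move=> CB.
rewrite -(@lee_pmul2l _ B%:E) // -?EFinM ?lte_fin //.
rewrite mulrC divfK ?lt0r_neq0 //.
apply: le_trans CB _; apply: esum_le_finite_sums => [i|r ur rA].
  by rewrite mulr_ge0 ?powR_ge0 // ltW.
rewrite -mulr_sumr EFinM lee_pmul2l ?lte_fin //.
by apply: esum_seq_le => // i; exact: powR_ge0.
Qed.

Lemma hausdorff_dim_lipschitz (L : R) : lipschitz_with L f ->
  (((ln L)^-1 * kappa)%:E * htop f [set: X] <= hausdorff_dim D)%E.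
Proof.
move=> /lipschitz_withP fL.
(* For [L <= 1] the inverse logarithm is at most 0, with [0^-1 = 0], so the bound is trivial. *)
have [L1|L1] := leP L 1.
  apply: le_trans (hausdorff_dim_ge0 _).
  rewrite mule_le0_ge0 ?htop_ge0 // lee_fin mulr_le0_ge0 //.
    by rewrite invr_le0 ln_le0.
  exact/ltW/entropy_factor_gt0.
have lnL : 0 < ln L by apply: ln_gt0.
rewrite -[_ * kappa]add0r; apply: hausdorff_dim_dense_covering_points => //.
  by rewrite invr_ge0 ltW.
move=> eps rho u re; exists 0%N, (Num.truncn (ln (eps / rho) / ln L)), u; split.
- by rewrite mul0r addr_ge0.
- by rewrite mulrC truncn_lbound.
move=> z uz k kn; rewrite metric_sym in uz.
by apply: (iter_mdist_lt L1 re fL) => //; exact: ltnW.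
Qed.

Lemma hausdorff_dim_bilipschitz (L1 L2 : R) : bilipschitz_homeo L1 L2 f ->
  (((ln L1)^-1 + (ln L2)^-1 * kappa)%:E * htop f [set: X] <= hausdorff_dim D)%E.
Proof.
move=> [g [[fgK gfK _ _] [gL1 fL2]]].
have fL := lipschitz_withP fL2; have gL := lipschitz_withP gL1.
have [x0 _] := Y0.
have [L21|L21] := leP L2 1.
  rewrite htop_nonexpanding ?mule0 ?hausdorff_dim_ge0 //; first by exists x0.
  move=> x y; apply: le_trans (fL x y) _.
  by rewrite ler_piMl // mdist_ge0.
(* Here the first summand is at most 0, and the one-sided bound suffices. *)
have [L11|L11] := leP L1 1.
  apply: le_trans (hausdorff_dim_lipschitz fL2).
  apply: lee_wpmul2r; first exact: htop_ge0.
  by rewrite lee_fin gerDr invr_le0 ln_le0.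
have lnL1 : 0 < ln L1 by apply: ln_gt0.
have lnL2 : 0 < ln L2 by apply: ln_gt0.
apply: hausdorff_dim_dense_covering_points; rewrite ?invr_ge0 ?ltW //.
move=> eps rho u re.
pose m := Num.truncn (ln (eps / rho) / ln L1).
pose n := Num.truncn (ln (eps / rho) / ln L2).
have iterfK k x : iter k g (iter k f x) = x.
  by elim: k x => //= k IHk x; rewrite -iterS iterSr fgK IHk.
have itergK k x : iter k f (iter k g x) = x.
  by elim: k x => //= k IHk x; rewrite -iterS iterSr gfK IHk.
(* This puts the small ball at time [m]: later times are reached from it by [f], earlier ones by
   [g]. *)
exists m, n, (iter m g u); split; [by rewrite mulrC truncn_lbound|by rewrite mulrC truncn_lbound|].
move=> z uz k kmn; rewrite metric_sym in uz.
have [mk|km] := leqP m k.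
  rewrite -(subnK mk) !iterD itergK.
  apply: (iter_mdist_lt L21 re fL) => //.
  by rewrite leq_subLR ltnW.
have kE x : iter k f x = iter (m - k) g (iter m f x).
  by rewrite -{2}(subnK (ltnW km)) iterD iterfK.
rewrite !kE itergK.
apply: (iter_mdist_lt L11 re gL) => //.
exact: leq_subr.
Qed.

Lemma dense_covering_conclusions :
  [/\ D !=set0, (kappa%:E * htop f [set: X] <= htop f D)%E,
      forall L : R, lipschitz_with L f ->
        (((ln L)^-1 * kappa)%:E * htop f [set: X] <= hausdorff_dim D)%E &
      forall L1 L2 : R, bilipschitz_homeo L1 L2 f ->
        (((ln L1)^-1 + (ln L2)^-1 * kappa)%:E * htop f [set: X]
           <= hausdorff_dim D)%E].
Proof.
split; [exact: dense_covering_points_nonempty|exact: htop_dense_covering_points|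
  exact: hausdorff_dim_lipschitz|exact: hausdorff_dim_bilipschitz].
Qed.

End dynamics.
End conclusions.

Unset Implicit Arguments.

Theorem corollary1p6 (R : realType) (X : metricType R) (f : X -> X)
    (Y : set X) (N : nat) (lambda1 lambda2 eps0 : R) (phi : nat -> R)
    (fsys : dynamical_system f)
    (flip : exists L : R, lipschitz_with L f)
    (Y0 : Y !=set0) (Ycompact : compact Y) (N0 : (0 < N)%N)
    (fNY : iter N f @` Y = Y)
    (XY : [set: X] = \bigcup_(l < N) (iter l f @` Y))
    (lambda1_gt0 : 0 < lambda1) (lambda2_gt0 : 0 < lambda2)
    (eps0_gt0 : 0 < eps0)
    (Yspec : exp_nonuniform_specification Y (iter N f)
               (N%:R * lambda1) (N%:R * lambda2) eps0)
    (phi01 : forall n, 0 < phi n <= 1) :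
  ((upper_rate phi < lambda1%:E)%E ->
    let c := entropy_factor lambda1 lambda2 (fine (upper_rate phi)) in
    [/\ dense_covering_points f phi !=set0,
        (c%:E * htop f [set: X] <= htop f (dense_covering_points f phi))%E,
        forall L : R, lipschitz_with L f ->
          (((ln L)^-1 * c)%:E * htop f [set: X]
             <= hausdorff_dim (dense_covering_points f phi))%E &
        forall L1 L2 : R, bilipschitz_homeo L1 L2 f ->
          (((ln L1)^-1 + (ln L2)^-1 * c)%:E * htop f [set: X]
             <= hausdorff_dim (dense_covering_points f phi))%E])
  /\
  (N = 1%N -> (lower_rate phi < lambda1%:E)%E ->
    let c := entropy_factor lambda1 lambda2 (fine (lower_rate phi)) in
    [/\ dense_covering_points f phi !=set0,
        (c%:E * htop f [set: X] <= htop f (dense_covering_points f phi))%E,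
        forall L : R, lipschitz_with L f ->
          (((ln L)^-1 * c)%:E * htop f [set: X]
             <= hausdorff_dim (dense_covering_points f phi))%E &
        forall L1 L2 : R, bilipschitz_homeo L1 L2 f ->
          (((ln L1)^-1 + (ln L2)^-1 * c)%:E * htop f [set: X]
             <= hausdorff_dim (dense_covering_points f phi))%E]).
Proof.
have [cX _ fc] := fsys.
have phi0 n : 0 < phi n by case/andP: (phi01 n).
split=> [up|N1 low].
  (* The rate is at least 0 and below a real number, hence finite, and [fine] returns its true
     value. *)
  move: up (upper_rate_ge0 phi01) (fun t => @upper_rate_hits _ _ phi01 N t N0).
  case: (upper_rate phi) => [tau| |] //=.
  rewrite lte_fin lee_fin => tau1 tau0 hits.
  exact: (dense_covering_conclusions cX fc flip Y0 N0 fNY XY lambda1_gt0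
    lambda2_gt0 eps0_gt0 Yspec phi0 tau0 tau1 (fun t tt => hits t tt)).
subst N.
move: low (lower_rate_ge0 phi01) (@lower_rate_hits _ _ phi01).
case: (lower_rate phi) => [tau| |] //=.
rewrite lte_fin lee_fin => tau1 tau0 hits.
exact: (dense_covering_conclusions cX fc flip Y0 N0 fNY XY lambda1_gt0
  lambda2_gt0 eps0_gt0 Yspec phi0 tau0 tau1 (fun t tt => hits t tt)).
Qed.
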